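(* Let $L$ be a finite-dimensional restricted Lie algebra over a field of prime characteristic. Then every abelian chief factor of $L$ belongs to the principal block of $L$.
   Context: A chief series of a finite-dimensional Lie algebra $L$ is an ascending chain $0=L_0\subset L_1\subset\cdots\subset L_n=L$ of (ordinary) ideals of $L$ such that $L_j/L_{j-1}$ is a minimal (non-zero) ideal of $L/L_{j-1}$ for every $1\le j\le n$; each $L_j/L_{j-1}$ is called a chief factor, and it is an irreducible $L$-module via the adjoint action (a restricted one if $L$ is restricted). It is called an abelian chief factor if it is an abelian Lie algebra. For a finite-dimensional restricted Lie algebra $L$ over a field $\mathbb{F}$, $u(L)$ denotes its restricted universal enveloping algebra, a finite-dimensional unital associative algebra whose modules are exactly the restricted $L$-modules. The principal block of $L$ is the block of $u(L)$ (i.e. of the decomposition of $u(L)$ into indecomposable two-sided ideals) to which the trivial irreducible module $\mathbb{F}$ belongs. *)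

(* Defs.v *)
From HB Require Import structures.
From mathcomp Require Import all_boot all_order all_algebra all_field.

Set Implicit Arguments.
Unset Strict Implicit.
Unset Printing Implicit Defensive.

Import GRing.Theory.
Local Open Scope ring_scope.

Section Bracket.
Variables (F : fieldType) (V : vectType F) (br : V -> V -> V).

Definition lie_axiom : Prop :=
  [/\ forall y, linear (br^~ y), forall x, linear (br x),
      forall x, br x x = 0
    & forall x y z, br x (br y z) + br y (br z x) + br z (br x y) = 0].

Definition is_ideal (I : {vspace V}) : Prop :=
  forall x y, y \in I -> br x y \in I.

Definition minimal_ideal (I : {vspace V}) : Prop :=
  [/\ is_ideal I, I <> 0%VS
    & forall K : {vspace V}, is_ideal K -> (K <= I)%VS -> K <> 0%VS -> K = I].

Definition abelian_on (I : {vspace V}) : Prop :=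
  {in I &, forall x y, br x y = 0}.

(* [ad_coef x y n i] is the coefficient of t^i in (ad (t x + y))^n (x),
   computed in L (x) F[t]. *)
Fixpoint ad_coef (x y : V) (n i : nat) : V :=
  match n with
  | 0 => if i is 0 then x else 0
  | n'.+1 => br y (ad_coef x y n' i) +
             (if i is i'.+1 then br x (ad_coef x y n' i') else 0)
  end.

(* Jacobson's s_i, defined for 0 < i < p by
   (ad (t x + y))^(p-1) (x) = \sum_(1 <= i < p) i s_i(x, y) t^(i-1). *)
Definition jacobson_s (p : nat) (x y : V) (i : nat) : V :=
  i%:R^-1 *: ad_coef x y p.-1 i.-1.

Definition pmap_axiom (p : nat) (pm : V -> V) : Prop :=
  [/\ forall x y, br (pm x) y = iter p (br x) y,
      forall a x, pm (a *: x) = a ^+ p *: pm x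
    & forall x y, pm (x + y) =
        pm x + pm y + \sum_(1 <= i < p) jacobson_s p x y i].

End Bracket.

(* [p] is meant to be the characteristic of [F]. *)
Record restrictedLieAlgebra (F : fieldType) (p : nat) := RestrictedLieAlgebra {
  rlie_sort :> vectType F;
  lie : rlie_sort -> rlie_sort -> rlie_sort;
  pmap : rlie_sort -> rlie_sort;
  lieP : lie_axiom lie;
  pmapP : pmap_axiom lie p pmap
}.

Section Quotient.
Variables (F : fieldType) (V : vectType F) (J : {vspace V}).

(* The vector space V / J, realised on a complement of J. *)
Definition quo : vectType F := subvs_of (J^C)%VS.

Definition quo_proj : 'Hom(V, quo) :=
  (linfun (@vsproj F V (J^C)%VS) \o daddv_pi (J^C)%VS J)%VF.

Definition quo_repr : 'Hom(quo, V) := linfun (@vsval F V (J^C)%VS).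

Lemma quo_projK v : quo_repr (quo_proj v) - v \in J.
Proof.
have dJ : (J^C :&: J = 0)%VS by rewrite capvC capv_compl.
have: v \in (J^C + J)%VS by rewrite addvC addv_complf memvf.
move=> /(daddv_pi_add dJ) e.
rewrite comp_lfunE !lfunE /= vsprojK ?memv_pi // -{2}e opprD addrA subrr add0r.
by rewrite memvN memv_pi.
Qed.

Lemma quo_reprK : cancel quo_repr quo_proj.
Proof.
move=> a; rewrite comp_lfunE !lfunE /= daddv_pi_id ?vsvalK //.
  by rewrite capvC capv_compl.
exact: subvsP.
Qed.

Lemma quo_proj_eq0 v : (quo_proj v == 0) = (v \in J).
Proof.
apply/eqP/idP => [e|vJ].
  by have := quo_projK v; rewrite e linear0 sub0r memvN.
have : quo_repr (quo_proj v) \in (J :&: J^C)%VS.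
  rewrite memv_cap -[X in X \in J](subrK v) memvD ?quo_projK //=.
  by rewrite lfunE subvsP.
rewrite capv_compl memv0 => /eqP e.
by rewrite -[LHS]quo_reprK e linear0.
Qed.

Definition quo_bracket (br : V -> V -> V) (a b : quo) : quo :=
  quo_proj (br (quo_repr a) (quo_repr b)).

Lemma quo_bracketE br x y : lie_axiom br -> is_ideal br J ->
  quo_bracket br (quo_proj x) (quo_proj y) = quo_proj (br x y).
Proof.
move=> [brl brr alt _] idJ.
have brBr u v w : br u (v - w) = br u v - br u w.
  by rewrite addrC -scaleN1r brr scaleN1r addrC.
have brBl u v w : br (v - w) u = br v u - br w u.
  by rewrite addrC -scaleN1r brl scaleN1r addrC.
have brDr u v w : br u (v + w) = br u v + br u w.
  by have := brr u 1 v w; rewrite !scale1r.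
have brDl u v w : br (v + w) u = br v u + br w u.
  by have := brl u 1 v w; rewrite !scale1r.
have antisym u v : br u v = - br v u.
  apply/eqP; rewrite -addr_eq0; apply/eqP.
  by have := alt (u + v); rewrite brDl !brDr !alt add0r addr0.
apply/eqP; rewrite -subr_eq0 -linearB /= quo_proj_eq0.
set x' := quo_repr _; set y' := quo_repr _.
have -> : br x' y' - br x y = br x' (y' - y) + br (x' - x) y.
  by rewrite brBr brBl addrA subrK.
by rewrite memvD ?(antisym _ y) ?memvN ?idJ ?quo_projK.
Qed.

End Quotient.

Section LieTheory.
Variables (F : fieldType) (p : nat) (L : restrictedLieAlgebra F p).

(* Ideals of the underlying Lie algebra: no closure under the p-map. *)
Definition lie_ideal (I : {vspace L}) : Prop := is_ideal (@lie F p L) I.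

(* I / J, as a subspace of L / J. *)
Definition factor (J I : {vspace L}) : {vspace quo J} := (quo_proj J @: I)%VS.

Definition chief_series (n : nat) (Ls : nat -> {vspace L}) : Prop :=
  [/\ Ls 0%N = 0%VS, Ls n = fullv,
      forall j, (j <= n)%N -> lie_ideal (Ls j),
      forall j, (j < n)%N -> (Ls j <= Ls j.+1)%VS /\ Ls j <> Ls j.+1
    & forall j, (j < n)%N ->
        minimal_ideal (quo_bracket (@lie F p L)) (factor (Ls j) (Ls j.+1))].

Definition abelian_factor (J I : {vspace L}) : Prop :=
  abelian_on (quo_bracket (@lie F p L)) (factor J I).

Lemma lie_is_linear (x : L) : linear (lie x).
Proof. by have [_ /(_ x)] := lieP L. Qed.

HB.instance Definition _ (x : L) :=
  GRing.isSemilinear.Build F L L _ (lie x)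
    (GRing.semilinear_linear (lie_is_linear x)).

(* The adjoint action of L on I / J:  x . (y + J) = [x, y] + J. *)
Definition factor_action (J I : {vspace L}) (x : L) :
    'End(subvs_of (factor J I)) :=
  (linfun (@vsproj F _ (factor J I)) \o quo_proj J \o linfun (lie x)
     \o quo_repr J \o linfun (@vsval F _ (factor J I)))%VF.

Lemma factor_actionE (J I : {vspace L}) (x y : L) :
    lie_ideal J -> lie_ideal I -> y \in I ->
  vsval (factor_action J I x (vsproj (factor J I) (quo_proj J y)))
    = quo_proj J (lie x y).
Proof.
move=> idJ idI yI; have yf z : z \in I -> quo_proj J z \in factor J I by exact: memv_img.
have e : quo_proj J (lie x (quo_repr J (quo_proj J y))) = quo_proj J (lie x y).
  apply/eqP; rewrite -subr_eq0 -!linearB /= quo_proj_eq0.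
  by apply: idJ; apply: quo_projK.
have -> : factor_action J I x (vsproj (factor J I) (quo_proj J y)) =
    vsproj (factor J I) (quo_proj J (lie x (quo_repr J
      (vsval (vsproj (factor J I) (quo_proj J y)))))).
  rewrite /factor_action 4!comp_lfunE [LHS]lfunE /=.
  by congr (vsproj _ (quo_proj J _)); rewrite lfunE /= [X in quo_repr J X]lfunE.
by rewrite (vsprojK (yf _ yI)) e vsprojK ?yf ?idI.
Qed.

Definition restricted_hom (A : algType F) (f : L -> A) : Prop :=
  (forall x y, f (lie x y) = f x * f y - f y * f x) /\
  (forall x, f (pmap x) = f x ^+ p).

(* (U, iota) is the restricted universal enveloping algebra u(L), given by its
   universal property among unital associative F-algebras. *)
Definition restricted_enveloping (U : falgType F) (iota : {linear L -> U}) :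
    Prop :=
  restricted_hom iota /\
  forall (A : algType F) (f : {linear L -> A}), restricted_hom f ->
    exists phi : {lrmorphism U -> A},
      (forall x, phi (iota x) = f x) /\
      (forall psi : {lrmorphism U -> A},
         (forall x, psi (iota x) = f x) -> psi =1 phi).

End LieTheory.

Section Blocks.
Variables (F : fieldType) (U : falgType F).

Definition two_sided_ideal (B : {vspace U}) : Prop :=
  ({:U} * B <= B)%VS /\ (B * {:U} <= B)%VS.

Definition indecomposable_ideal (B : {vspace U}) : Prop :=
  [/\ two_sided_ideal B, B <> 0%VS
    & forall B1 B2 : {vspace U}, two_sided_ideal B1 -> two_sided_ideal B2 ->
        (B1 + B2 = B)%VS -> (B1 :&: B2 = 0)%VS -> B1 = 0%VS \/ B2 = 0%VS].

Definition block_decomposition (r : nat) (Bs : 'I_r -> {vspace U}) : Prop :=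
  [/\ forall i, indecomposable_ideal (Bs i),
      directv (\sum_i Bs i) & (\sum_i Bs i)%VS = fullv].

Definition is_module (V : vectType F) (act : U -> 'End(V)) : Prop :=
  [/\ linear act, act 1 = \1%VF & forall a b, act (a * b) = (act a \o act b)%VF].

(* B_i V = V, and every other block annihilates V. *)
Definition in_block (r : nat) (Bs : 'I_r -> {vspace U}) (i : 'I_r)
    (V : vectType F) (act : U -> 'End(V)) : Prop :=
  (\sum_(b <- vbasis (Bs i)) limg (act b))%VS = fullv /\
  forall k, k != i -> {in Bs k, forall c, act c = 0}.

End Blocks.

Section PrincipalBlock.
Variables (F : fieldType) (p : nat) (L : restrictedLieAlgebra F p).
Variables (U : falgType F) (iota : {linear L -> U}).

(* The u(L)-module structure [act] on V induces the L-action [rho]. *)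
Definition extends_action (V : vectType F) (rho : L -> 'End(V))
    (act : U -> 'End(V)) : Prop :=
  is_module act /\ forall x, act (iota x) = rho x.

Definition belongs_to_block (r : nat) (Bs : 'I_r -> {vspace U}) (i : 'I_r)
    (V : vectType F) (rho : L -> 'End(V)) : Prop :=
  exists2 act : U -> 'End(V), extends_action rho act & in_block Bs i act.

Definition trivial_action (x : L) : 'End(F^o) := 0.

(* V lies in the same block of u(L) as the trivial module F. *)
Definition in_principal_block (V : vectType F) (rho : L -> 'End(V)) : Prop :=
  exists (r : nat) (Bs : 'I_r -> {vspace U}) (i : 'I_r),
    [/\ block_decomposition Bs, belongs_to_block Bs i trivial_action
      & belongs_to_block Bs i rho].

End PrincipalBlock.

(* Main.v *)
Require Import Defs.
From HB Require Import structures.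
From mathcomp Require Import all_boot all_order all_algebra all_field.
From mathcomp Require Import zify.
From Stdlib Require Classical_Prop.

(** Suppose that the abelian chief factor S = I/J belongs to another block than
    the trivial module.  The idempotent f of the block of S is then a central
    element of u(L) that acts as the identity on S and as 0 on the trivial
    module; the latter says that f lies in the augmentation ideal u+.  For x in
    I, centrality gives f x = x f, which lies in I u+.  Hence f annihilates the
    image of I in u(L) / I u+.  In this quotient y x is congruent to [y, x] for
    all y in L, so the image of I is a quotient of I as an L-module.  If the
    image still has S as a quotient, f kills S, a contradiction.

    The image of I in u(L) / I u+ may be smaller than expected: the relations
    [I, I] and x^[p] for x in I vanish there.  The remedy is to enlarge J to
    Z = { x | [L, x] is contained in J }.  This ideal is stable under the p-map,
    contains x^[p] for every x in I (since ad(x)^2 maps L into J), and contains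
    I only if L acts trivially on S.  In L/Z the image of I is an abelian ideal
    whose elements may be given the p-th power 0, so the restricted
    Poincare-Birkhoff-Witt theorem for L/Z yields a module W with a vector w1
    and its augmentation part W+ such that the class modulo Z of x in I can be
    read off from x w1 modulo I W+ ([annihilator_module]).  As
    f x w1 = x f w1 lies in I W+, while f x w1 is congruent to x w1, every x in
    I lies in Z.  So L acts trivially on S, and f acts on S as it does on the
    trivial module, that is, as 0 ([central_acting_as_id]).

    The Poincare-Birkhoff-Witt theorem ([pbw_module]) comes from a diamond lemma
    for rewriting words in a basis of the Lie algebra, with rules
    e_j e_i -> e_i e_j + [e_j, e_i] for i < j and e_i^p -> e_i^[p].  Its
    data are p-th powers of the basis vectors, and the module it produces
    satisfies the p-power relation for these vectors; Jacobson's formula for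
    (a + b)^p extends the relation to the whole Lie algebra
    ([jacobson_formula], [pmap_compatible_lin]).

    Blocks come from a maximal splitting of u(L) into two-sided ideals; the
    components of 1 are central idempotents, and an irreducible module sees
    exactly one of them ([irreducible_in_block]).  Identities between actions of
    u(L) are checked on products of elements of L, which span u(L) by the
    uniqueness part of the universal property ([enveloping_ind]). *)

Set Implicit Arguments.
Unset Strict Implicit.
Unset Printing Implicit Defensive.

Import GRing.Theory.
Local Open Scope ring_scope.

(** * Normal forms for linear rewriting of words *)

Section Diamond.

Variables (F : fieldType) (T : eqType) (W : lmodType F).
(** A rule rewrites a word into a formal linear combination of words, kept as a
    list of coefficients and words.  A map on words with values in a module
    stands for its linear extension to the free algebra. *)
Variables (rew : seq T -> option (seq (F * seq T))) (rank : seq T -> nat).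

Definition rew_at (N : seq T -> W) (r : seq (F * seq T)) (u v : seq T) : W :=
  \sum_(cx <- r) cx.1 *: N (u ++ cx.2 ++ v).

Definition irreducible (w : seq T) : Prop :=
  forall u l v, w = u ++ l ++ v -> rew l = None.

Definition respects (N : seq T -> W) (P : pred (seq T)) : Prop :=
  forall u l v r, rew l = Some r -> P (u ++ l ++ v) ->
    N (u ++ l ++ v) = rew_at N r u v.

(** [redex] picks one occurrence of a left-hand side; which one is immaterial,
    by confluence. *)
Definition redex (w : seq T) : option (seq T * seq (F * seq T) * seq T) :=
  if [pick ab : 'I_(size w).+1 * 'I_(size w).+1 |
        rew (take ab.2 (drop ab.1 w))] is Some (a, b)
  then omap (fun r => (take a w, r, drop b (drop a w)))
         (rew (take b (drop a w)))
  else None.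

Variant redex_spec (w : seq T) :
  option (seq T * seq (F * seq T) * seq T) -> Prop :=
| RedexSome u l v r of w = u ++ l ++ v & rew l = Some r :
    redex_spec w (Some (u, r, v))
| RedexNone of irreducible w : redex_spec w None.

Lemma redexP w : redex_spec w (redex w).
Proof.
rewrite /redex; case: pickP => [[a b] /=|none].
  case e: (rew _) => [r|] // _; apply: (RedexSome _ e).
  by rewrite !cat_take_drop.
constructor=> u l v ew.
have ltu : (size u < (size w).+1)%N by rewrite ltnS ew !size_cat leq_addr.
have ltl : (size l < (size w).+1)%N.
  by rewrite ltnS ew !size_cat addnCA leq_addr.
have := none (Ordinal ltu, Ordinal ltl).
by rewrite /= ew drop_size_cat // take_size_cat //; case: rew.
Qed.

Lemma reducible_dec w : irreducible w \/
  exists u l v r, w = u ++ l ++ v /\ rew l = Some r.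
Proof. by case: (redexP w) => [u l v r *|]; [right; exists u, l, v, r | left]. Qed.

Hypothesis rank_rew : forall u l v r, rew l = Some r ->
  forall cx, cx \in r -> (rank (u ++ cx.2 ++ v) < rank (u ++ l ++ v))%N.

Variable delta : seq T -> W.

(** The fuel bounds the rank of the word, which drops at each rewriting step. *)
Fixpoint nf_fuel (k : nat) (w : seq T) : W :=
  if k is k'.+1 then
    if redex w is Some (u, r, v) then rew_at (nf_fuel k') r u v else delta w
  else 0.

Lemma nf_fuelE k w : (rank w < k)%N -> nf_fuel k w = nf_fuel (rank w).+1 w.
Proof.
elim/ltn_ind: k w => -[//|k] IH w wk /=.
case: redexP => // u l v r ew rl.
rewrite /rew_at; apply: eq_big_seq => cx cxr; congr (_ *: _).
have lt := rank_rew u v rl cxr; rewrite -ew in lt.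
rewrite IH ?(leq_trans lt) //.
by rewrite [RHS]IH.
Qed.

Definition nf w := nf_fuel (rank w).+1 w.

Lemma nfE w :
  nf w = if redex w is Some (u, r, v) then rew_at nf r u v else delta w.
Proof.
rewrite {1}/nf /=; case: redexP => // u l v r ew rl.
apply: eq_big_seq => cx cxr; congr (_ *: _); apply: nf_fuelE.
by rewrite ew (rank_rew u v rl cxr).
Qed.

(** Two rewritings at disjoint places agree because the other rule can still be
    applied to each word of the result, which has smaller rank. *)
Lemma rew_at_disjoint N w u l m l' v r r' :
    respects N (fun w' => rank w' < rank w)%N ->
    rew l = Some r -> rew l' = Some r' -> w = u ++ l ++ m ++ l' ++ v ->
  rew_at N r u (m ++ l' ++ v) = rew_at N r' (u ++ l ++ m) v.
Proof.
move=> HN rl rl' ew.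
transitivity (\sum_(cx <- r) \sum_(dy <- r')
    (cx.1 * dy.1) *: N (u ++ cx.2 ++ m ++ dy.2 ++ v)).
  apply: eq_big_seq => cx cxr.
  have := HN (u ++ cx.2 ++ m) l' v r' rl'.
  rewrite -!catA => ->; last by rewrite ew; apply: rank_rew rl _ cxr.
  rewrite scaler_sumr; apply: eq_bigr => dy _; by rewrite scalerA -!catA.
rewrite exchange_big /=; apply: eq_big_seq => dy dyr.
have := HN u l (m ++ dy.2 ++ v) r rl.
rewrite -!catA => ->; last first.
  by have := rank_rew (u ++ l ++ m) v rl' dyr; rewrite ew -!catA.
by rewrite scaler_sumr; apply: eq_bigr => cx _; rewrite scalerA mulrC.
Qed.

(** Local confluence is required only modulo the rules on words of smaller rank:
    both results must agree under every map that respects those rules. *)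
Hypothesis overlap : forall N u l v m l' v' r r',
    respects N (fun w => rank w < rank (u ++ l ++ v))%N ->
    rew l = Some r -> rew l' = Some r' ->
    l ++ v = m ++ l' ++ v' -> (size m < size l)%N ->
  rew_at N r u v = rew_at N r' (u ++ m) v'.

Lemma confluent N u l v u' l' v' r r' :
    respects N (fun w => rank w < rank (u ++ l ++ v))%N ->
    rew l = Some r -> rew l' = Some r' ->
    u ++ l ++ v = u' ++ l' ++ v' -> (size u <= size u')%N ->
  rew_at N r u v = rew_at N r' u' v'.
Proof.
move=> HN rl rl' e leu.
have eu : u' = u ++ drop (size u) u'.
  have := congr1 (take (size u)) e.
  rewrite take_size_cat // takel_cat // => {1}->.
  by rewrite cat_take_drop.
move: (drop _ _) eu => m eu; rewrite {}eu {u' leu} in e *.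
have {}e : l ++ v = m ++ l' ++ v'.
  by have := congr1 (drop (size u)) e; rewrite -catA !drop_size_cat.
case: (ltnP (size m) (size l)) => [ltm|lem]; first exact: (overlap HN rl rl' e).
have em : m = l ++ drop (size l) m.
  have := congr1 (take (size l)) e.
  rewrite take_size_cat // takel_cat // => {1}->.
  by rewrite cat_take_drop.
move: (drop _ _) em => m' em; rewrite {}em {m lem} in e *.
have {}e : v = m' ++ l' ++ v'.
  by have := congr1 (drop (size l)) e; rewrite -catA !drop_size_cat.
by rewrite e; apply: (rew_at_disjoint HN rl rl'); rewrite e.
Qed.

(** The diamond lemma.  By induction on the rank, rewriting a word at an
    arbitrary place gives the same value as rewriting it at the place chosen by
    [redex]. *)
Lemma nf_respects : respects nf predT.
Proof.
suff H k : respects nf (fun w => rank w < k)%N.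
  by move=> u l v r rl _; apply: (H (rank (u ++ l ++ v)).+1).
elim: k => [|k IH] u l v r rl //; rewrite ltnS leq_eqVlt.
case/predU1P => [ek|]; last exact: IH.
have {}IH : respects nf (fun w => rank w < rank (u ++ l ++ v))%N by rewrite ek.
rewrite nfE; case: redexP => [u' l' v' r' e rl'|/(_ u l v erefl)]; last by rewrite rl.
case: (leqP (size u) (size u')) => [le|/ltnW le].
  by rewrite -(confluent IH rl rl' e le).
by rewrite e in IH; rewrite (confluent IH rl' rl (esym e) le).
Qed.

Lemma nf_irreducible w : irreducible w -> nf w = delta w.
Proof.
by move=> irr; rewrite nfE; case: redexP => // u l v r /irr ->.
Qed.

End Diamond.

(** * Powers of inner derivations in characteristic p *)

Section CharPBinomials.

Variables (F : fieldType) (p : nat) (hp : p \in [pchar F]).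

Lemma signed_bin_pred (k : nat) : (k < p)%N -> (-1) ^+ k * 'C(p.-1, k)%:R = 1 :> F.
Proof.
have p0 : (0 < p)%N := prime_gt0 (pcharf_prime hp).
elim: k => [|k IH] kp; first by rewrite bin0 mul1r.
have /eqP : 'C(p, k.+1)%:R = 0 :> F.
  have /dvdnP [q ->] : (p %| 'C(p, k.+1))%N.
    by rewrite prime_dvd_bin ?(pcharf_prime hp).
  by rewrite natrM (pcharf0 hp) mulr0.
rewrite -{1}(prednK p0) binS natrD addr_eq0 => /eqP ->.
by rewrite exprS mulrN mulN1r mulNr opprK IH // ltnW.
Qed.

Lemma pascal_sum (W : lmodType F) (m : nat) (Y : nat -> W) :
  \sum_(k < m.+1) ((-1) ^+ k * 'C(m, k)%:R) *: (Y k - Y k.+1) =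
  \sum_(k < m.+2) ((-1) ^+ k * 'C(m.+1, k)%:R) *: Y k.
Proof.
under eq_bigr do rewrite scalerBr.
rewrite sumrB [RHS]big_ord_recl /= bin0.
under [in RHS]eq_bigr do
  rewrite /bump add1n binS natrD mulrDr scalerDl [in X in _ + X]exprS !mulN1r
          mulNr scaleNr.
rewrite sumrB addrA; congr (_ - _).
have /esym := @big_ord_recl W 0 +%R m.+1
  (fun k : 'I_m.+2 => ((-1) ^+ k * 'C(m, k)%:R) *: Y k).
rewrite /= bin0 => ->.
by rewrite [RHS]big_ord_recr /= (@bin_small m m.+1) // mulr0 scale0r addr0.
Qed.

(** With X a b c standing for x^a c x^b and D for ad(x), this is the binomial
    expansion of ad(x)^m as the m-th power of the difference of left and right
    multiplication by x.  Only the exponents a, b occurring in it are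
    constrained, so that it applies to values known to satisfy the commutation
    rule in bounded degree. *)
Lemma iter_ad_expansion (V : Type) (W : lmodType F) (D : V -> V)
    (X : nat -> nat -> V -> W) (m : nat) :
    (forall a b c, (a + b < m)%N -> X a b (D c) = X a.+1 b c - X a b.+1 c) ->
  forall c, X 0 0 (iter m D c) =
    \sum_(k < m.+1) ((-1) ^+ k * 'C(m, k)%:R) *: X (m - k)%N k c.
Proof.
move=> HX.
suff H m' : forall a b c, (a + b + m' <= m)%N -> X a b (iter m' D c) =
    \sum_(k < m'.+1) ((-1) ^+ k * 'C(m', k)%:R) *: X (a + (m' - k))%N (b + k)%N c.
  by move=> c; rewrite H.
elim: m' => [|m' IH] a b c le.
  by rewrite big_ord1 mul1r scale1r !addn0.
rewrite iterSr IH; last by apply: leq_trans le; rewrite addnS.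
rewrite -(pascal_sum m' (fun k => X (a + (m'.+1 - k))%N (b + k)%N c)).
apply: eq_bigr => k _; have km : (k <= m')%N by rewrite -ltnS.
by rewrite HX ?subSS -?addnS ?subSn //; lia.
Qed.

(** In characteristic p, (l - r)^(p-1) is the sum of the l^(p-1-k) r^k. *)
Lemma iter_ad_sum (V : Type) (W : lmodType F) (D : V -> V)
    (X : nat -> nat -> V -> W) :
    (forall a b c, (a + b < p.-1)%N -> X a b (D c) = X a.+1 b c - X a b.+1 c) ->
  forall c, X 0 0 (iter p.-1 D c) = \sum_(k < p) X (p.-1 - k)%N k c.
Proof.
move=> HX c; rewrite (iter_ad_expansion HX).
rewrite (prednK (prime_gt0 (pcharf_prime hp))).
by apply: eq_bigr => k _; rewrite signed_bin_pred // scale1r.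
Qed.

End CharPBinomials.

(** * Brackets *)

Section BracketTheory.

Variables (F : fieldType) (g : vectType F) (br : g -> g -> g).
Hypothesis brP : lie_axiom br.

Lemma br_lin_l y : linear (br^~ y). Proof. by case: brP. Qed.
Lemma br_lin_r x : linear (br x). Proof. by case: brP. Qed.
Lemma br_alt x : br x x = 0. Proof. by case: brP. Qed.

Lemma brDl x x' y : br (x + x') y = br x y + br x' y.
Proof. by have := br_lin_l y 1 x x'; rewrite !scale1r. Qed.
Lemma brDr x y y' : br x (y + y') = br x y + br x y'.
Proof. by have := br_lin_r x 1 y y'; rewrite !scale1r. Qed.
Lemma br0l y : br 0 y = 0.
Proof. by apply: (addIr (br 0 y)); rewrite -brDl !add0r. Qed.
Lemma br0r x : br x 0 = 0.
Proof. by apply: (addIr (br x 0)); rewrite -brDr !add0r. Qed.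
Lemma brZl a x y : br (a *: x) y = a *: br x y.
Proof. by have := br_lin_l y a x 0; rewrite br0l !addr0. Qed.
Lemma brZr a x y : br x (a *: y) = a *: br x y.
Proof. by have := br_lin_r x a y 0; rewrite br0r !addr0. Qed.

Lemma br_suml I (r : seq I) (P : pred I) (f : I -> g) y :
  br (\sum_(i <- r | P i) f i) y = \sum_(i <- r | P i) br (f i) y.
Proof. by apply: (big_morph (br^~ y)) => [x x'|]; rewrite ?brDl ?br0l. Qed.
Lemma br_sumr I (r : seq I) (P : pred I) (f : I -> g) x :
  br x (\sum_(i <- r | P i) f i) = \sum_(i <- r | P i) br x (f i).
Proof. by apply: (big_morph (br x)) => [y y'|]; rewrite ?brDr ?br0r. Qed.

Lemma br_anti x y : br x y = - br y x.
Proof.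
apply/eqP; rewrite -addr_eq0; apply/eqP.
by have := br_alt (x + y); rewrite brDl !brDr !br_alt add0r addr0.
Qed.

Lemma brNr x y : br x (- y) = - br x y.
Proof. by rewrite -scaleN1r brZr scaleN1r. Qed.

Lemma br_flip x y z : br (br x y) z = br z (br y x).
Proof. by rewrite br_anti -brNr -br_anti. Qed.

Lemma br_jacobi x y z : br (br z y) x + br (br y x) z = br (br z x) y.
Proof.
have [_ _ _ /(_ x y z)/eqP] := brP.
by rewrite !br_flip addrAC addr_eq0 -brNr -br_anti => /eqP.
Qed.

Lemma br_leibniz x y z : br (br x y) z = br x (br y z) - br y (br x z).
Proof.
rewrite -(br_flip z y x) -(br_flip z x y) -(br_jacobi x y z) opprD addrA subrr add0r.
by rewrite [X in - X]br_flip -br_anti.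
Qed.

End BracketTheory.

(** * Confluence of the Poincare-Birkhoff-Witt rules *)
Section Inversions.

Variable n : nat.

Fixpoint inversions (w : seq 'I_n) : nat :=
  if w is i :: w' then (count (fun j : 'I_n => (j < i)%N) w' + inversions w')%N
  else 0.

(** The cube makes the length dominate: a word of length s has at most s^2
    inversions, and (s + 1)^3 > s^3 + s^2. *)
Definition word_rank (w : seq 'I_n) : nat := (size w ^ 3 + inversions w)%N.

Lemma inversions_le w : (inversions w <= size w ^ 2)%N.
Proof.
elim: w => //= i w IH; rewrite -mulnn mulSn mulnS mulnn.
by have := count_size (fun j : 'I_n => (j < i)%N) w; lia.
Qed.

Lemma word_rank_size w w' : (size w < size w')%N -> (word_rank w < word_rank w')%N.
Proof. move=> lt; apply: (@leq_trans ((size w).+1 ^ 3)); last first.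
  by apply: leq_trans (leq_addr _ _); rewrite leq_exp2r.
have := inversions_le w; rewrite /word_rank !expnS expn0 => le; nia.
Qed.

Lemma word_rank_swap (i j : 'I_n) u v : (i < j)%N ->
  (word_rank (u ++ [:: i, j & v]) < word_rank (u ++ [:: j, i & v]))%N.
Proof.
move=> ij; rewrite /word_rank !size_cat /= ltn_add2l.
elim: u => [|k u IH] /=; last first.
  by rewrite !count_cat /=; lia.
by rewrite ij [(j < i)%N]ltnNge (ltnW ij) /=; lia.
Qed.

End Inversions.

Section PBWRules.

Variables (F : fieldType) (p : nat) (hp : p \in [pchar F]).
Variables (g : vectType F) (br : g -> g -> g) (brP : lie_axiom br).
(** [q i] is the prescribed p-th power of the basis vector [e`_i]. *)
Variables (n : nat) (e : n.-tuple g) (q : 'I_n -> g).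
Hypothesis e_basis : basis_of fullv e.
Hypothesis q_ad : forall (i : 'I_n) x, br (q i) x = iter p (br e`_i) x.

Let p_gt1 : (1 < p)%N := prime_gt1 (pcharf_prime hp).

Lemma coord_sum x : x = \sum_(k < n) coord e k x *: e`_k.
Proof. exact: coord_basis e_basis (memvf x). Qed.

Definition letters (x : g) : seq (F * seq 'I_n) :=
  [seq (coord e k x, [:: k]) | k <- enum 'I_n].

Definition pbw_pow (l : seq 'I_n) : option (seq (F * seq 'I_n)) :=
  if l is i :: _ then
    if l == nseq p i then Some (letters (q i)) else None
  else None.

Definition pbw_rew (l : seq 'I_n) : option (seq (F * seq 'I_n)) :=
  if l is [:: j; i] then
    if (i < j)%N then Some ((1, [:: i; j]) :: letters (br e`_j e`_i))
    else pbw_pow l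
  else pbw_pow l.

Variant pbw_rule : seq 'I_n -> seq (F * seq 'I_n) -> Prop :=
| PBWSwap (i j : 'I_n) of (i < j)%N :
    pbw_rule [:: j; i] ((1, [:: i; j]) :: letters (br e`_j e`_i))
| PBWPow i : pbw_rule (nseq p i) (letters (q i)).

Lemma pbw_powP l r : pbw_pow l = Some r -> pbw_rule l r.
Proof. by case: l => //= i l; case: eqP => // -> [<-]; constructor. Qed.

Lemma pbw_rewP l r : pbw_rew l = Some r -> pbw_rule l r.
Proof.
case: l => [|j [|i [|k l]]]; try exact: pbw_powP.
by rewrite /pbw_rew; case: ltnP => [ij [<-]|_]; [constructor | apply: pbw_powP].
Qed.

Lemma pbw_rew_swap (i j : 'I_n) : (i < j)%N ->
  pbw_rew [:: j; i] = Some ((1, [:: i; j]) :: letters (br e`_j e`_i)).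
Proof. by rewrite /= => ->. Qed.

Lemma pbw_rew_pow i : pbw_rew (nseq p i) = Some (letters (q i)).
Proof.
have -> : pbw_rew (nseq p i) = pbw_pow (nseq p i).
  by case: p p_gt1 => [|[|[|m]]] //= _; rewrite ltnn.
by rewrite /pbw_pow; case: p p_gt1 => //= m _; rewrite eqxx.
Qed.

Lemma pbw_rank u l v r : pbw_rew l = Some r -> forall cx, cx \in r ->
  (word_rank (u ++ cx.2 ++ v) < word_rank (u ++ l ++ v))%N.
Proof.
have small x l' cx : (1 < size l')%N -> cx \in letters x ->
    (word_rank (u ++ cx.2 ++ v) < word_rank (u ++ l' ++ v))%N.
  move=> lt /mapP[k _ ->]; apply: word_rank_size.
  by rewrite !size_cat /= ltn_add2l ltn_add2r.
case/pbw_rewP => [i j ij cx|i cx]; last by apply: small; rewrite size_nseq.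
by rewrite inE => /predU1P[->|]; [apply: word_rank_swap | apply: small].
Qed.

Section Confluence.

Variable W : lmodType F.
Implicit Types (N : seq 'I_n -> W) (u v : seq 'I_n).

(** [with_letter N u x v] is the value of N, extended linearly, on the word u x v
    where x is a vector in place of a letter; [with_letters] is the analogue for
    two adjacent vectors. *)
Definition with_letter N u x v : W :=
  \sum_(k < n) coord e k x *: N (u ++ k :: v).

Definition with_letters N u x y v : W :=
  \sum_(k < n) coord e k x *: with_letter N (rcons u k) y v.

Lemma with_letter_linear N u v : linear (fun x => with_letter N u x v).
Proof.
move=> a x y; rewrite /with_letter scaler_sumr -big_split; apply: eq_bigr => k _.
by rewrite linearP scalerDl scalerA.
Qed.

Lemma with_letterD N u v x y :
  with_letter N u (x + y) v = with_letter N u x v + with_letter N u y v.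
Proof. by have := with_letter_linear N u v 1 x y; rewrite !scale1r. Qed.

Lemma with_letter0 N u v : with_letter N u 0 v = 0.
Proof. by apply: (addIr (with_letter N u 0 v)); rewrite -with_letterD !add0r. Qed.

Lemma with_letterZ N u v a x : with_letter N u (a *: x) v = a *: with_letter N u x v.
Proof.
by have := with_letter_linear N u v a x 0; rewrite with_letter0 !addr0.
Qed.

Lemma with_letterN N u v x : with_letter N u (- x) v = - with_letter N u x v.
Proof. by rewrite -!scaleN1r with_letterZ. Qed.

Lemma with_letter_sum N u v I (r : seq I) (f : I -> g) :
  with_letter N u (\sum_(i <- r) f i) v = \sum_(i <- r) with_letter N u (f i) v.
Proof.
apply: (big_morph (fun x => with_letter N u x v)) => [x y|].
  exact: with_letterD.
exact: with_letter0.
Qed.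

Lemma coord_e (i k : 'I_n) : coord e k e`_i = (k == i)%:R.
Proof. by rewrite coord_free ?(basis_free e_basis) // eq_sym. Qed.

Lemma with_letter_e N u (i : 'I_n) v : with_letter N u e`_i v = N (u ++ i :: v).
Proof.
rewrite /with_letter (bigD1 i) //= coord_e eqxx scale1r big1 ?addr0 // => k ki.
by rewrite coord_e (negbTE ki) scale0r.
Qed.

Lemma with_letters_el N u (i : 'I_n) y v :
  with_letters N u e`_i y v = with_letter N (rcons u i) y v.
Proof.
rewrite /with_letters (bigD1 i) //= coord_e eqxx scale1r big1 ?addr0 // => k ki.
by rewrite coord_e (negbTE ki) scale0r.
Qed.

Lemma with_letters_er N u x (i : 'I_n) v :
  with_letters N u x e`_i v = with_letter N u x (i :: v).
Proof.
by apply: eq_bigr => k _; rewrite with_letter_e cat_rcons.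
Qed.

Lemma rew_at_letters N u x v : rew_at N (letters x) u v = with_letter N u x v.
Proof. by rewrite /rew_at big_map big_enum. Qed.

Lemma respects_swap N P (i j : 'I_n) u v :
    respects pbw_rew N P -> (i < j)%N -> P (u ++ [:: j, i & v]) ->
  N (u ++ [:: j, i & v]) =
    N (u ++ [:: i, j & v]) + with_letter N u (br e`_j e`_i) v.
Proof.
move=> HN ij Pw; rewrite (HN u [:: j; i] v _ (pbw_rew_swap ij) Pw).
by rewrite /rew_at big_cons scale1r -/(rew_at _ _ _ _) rew_at_letters.
Qed.

Lemma respects_pow N P (i : 'I_n) u v :
    respects pbw_rew N P -> P (u ++ nseq p i ++ v) ->
  N (u ++ nseq p i ++ v) = with_letter N u (q i) v.
Proof.
by move=> HN Pw; rewrite (HN u (nseq p i) v _ (pbw_rew_pow i) Pw) rew_at_letters.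
Qed.

Lemma respects_commutator_basis N P (i j : 'I_n) u v :
    respects pbw_rew N P -> P (u ++ [:: j, i & v]) -> P (u ++ [:: i, j & v]) ->
  N (u ++ [:: j, i & v]) - N (u ++ [:: i, j & v]) =
    with_letter N u (br e`_j e`_i) v.
Proof.
move=> HN Pji Pij; case: (ltngtP i j) => [ij|ji|/ord_inj ->].
- by rewrite (respects_swap HN ij Pji) addrC addKr.
- rewrite (respects_swap HN ji Pij) opprD addrA subrr add0r.
  by rewrite -with_letterN -br_anti.
by rewrite subrr br_alt // with_letter0.
Qed.

(** The swap rules on basis letters amount to the relation x y - y x = [x, y] for
    all vectors x, y; the case of equal letters is [x, x] = 0, and that of
    letters in increasing order is antisymmetry. *)
Lemma respects_commutator N d x y u v :
    respects pbw_rew N (fun w => size w < d)%N -> (size u + size v + 2 < d)%N ->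
  with_letters N u x y v - with_letters N u y x v = with_letter N u (br x y) v.
Proof.
move=> HN ltd.
have -> : br x y = \sum_(k < n) \sum_(l < n)
    (coord e k x * coord e l y) *: br e`_k e`_l.
  rewrite {1}[x]coord_sum br_suml //; apply: eq_bigr => k _.
  rewrite {1}[y]coord_sum br_sumr //; apply: eq_bigr => l _.
  by rewrite brZl // brZr // scalerA.
have -> : with_letters N u y x v = \sum_(k < n) \sum_(l < n)
    (coord e k x * coord e l y) *: N (u ++ [:: l, k & v]).
  rewrite exchange_big /=; apply: eq_bigr => l _.
  rewrite /with_letter scaler_sumr; apply: eq_bigr => k _.
  by rewrite scalerA mulrC cat_rcons.
have -> : with_letters N u x y v = \sum_(k < n) \sum_(l < n)
    (coord e k x * coord e l y) *: N (u ++ [:: k, l & v]).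
  apply: eq_bigr => l _.
  rewrite /with_letter scaler_sumr; apply: eq_bigr => k _.
  by rewrite scalerA cat_rcons.
rewrite -sumrB with_letter_sum; apply: eq_bigr => k _.
rewrite -sumrB with_letter_sum; apply: eq_bigr => l _.
rewrite -scalerBr with_letterZ; congr (_ *: _).
by apply: (respects_commutator_basis HN); rewrite size_cat /=; lia.
Qed.

Lemma respects_ad N d x (i : 'I_n) u v :
    respects pbw_rew N (fun w => size w < d)%N -> (size u + size v + 2 < d)%N ->
  with_letter N u x (i :: v) =
    with_letter N (rcons u i) x v + with_letter N u (br x e`_i) v.
Proof.
move=> HN ltd; rewrite -(respects_commutator _ _ HN ltd).
by rewrite with_letters_er with_letters_el addrC subrK.
Qed.

Lemma respects_rank_size N (w : seq 'I_n) :
    respects pbw_rew N (fun w' => word_rank w' < word_rank w)%N ->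
  respects pbw_rew N (fun w' => size w' < size w)%N.
Proof. by move=> HN u l v r rl /word_rank_size; apply: HN. Qed.

Lemma rew_at_swap N (i j : 'I_n) x u v :
  rew_at N ((1, [:: i; j]) :: letters x) u v =
    N (u ++ [:: i, j & v]) + with_letter N u x v.
Proof.
by rewrite /rew_at big_cons scale1r -/(rew_at _ _ _ _) rew_at_letters.
Qed.

(** Both ways of sorting e_k e_j e_i end in e_i e_j e_k plus words of length two;
    these words agree by the Jacobi identity. *)
Lemma overlap_swap_swap N (i j k : 'I_n) u v : (i < j)%N -> (j < k)%N ->
    respects pbw_rew N
      (fun w => word_rank w < word_rank (u ++ [:: k, j, i & v]))%N ->
  N (u ++ [:: j, k, i & v]) + with_letter N u (br e`_k e`_j) (i :: v) =
  N (rcons u k ++ [:: i, j & v]) + with_letter N (rcons u k) (br e`_j e`_i) v.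
Proof.
move=> ij jk HN; have ik := ltn_trans ij jk.
have HNs := respects_rank_size HN.
have lt1 : (word_rank (u ++ [:: j, k, i & v]) <
            word_rank (u ++ [:: k, j, i & v]))%N by apply: word_rank_swap.
have lt2 : (word_rank (u ++ [:: j, i, k & v]) <
            word_rank (u ++ [:: j, k, i & v]))%N.
  by rewrite -2!(cat_rcons j); apply: word_rank_swap.
have lt3 : (word_rank (u ++ [:: k, i, j & v]) <
            word_rank (u ++ [:: k, j, i & v]))%N.
  by rewrite -2!(cat_rcons k); apply: word_rank_swap.
have lt4 : (word_rank (u ++ [:: i, k, j & v]) <
            word_rank (u ++ [:: k, i, j & v]))%N by apply: word_rank_swap.
have ltC : (size u + size v + 2 < size (u ++ [:: k, j, i & v]))%N.
  by rewrite size_cat /=; lia.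
have E1 := respects_swap (u := rcons u j) (v := v) HN ik.
have E2 := respects_swap (u := u) (v := k :: v) HN ij.
have E3 := respects_swap (u := u) (v := j :: v) HN ik.
have E4 := respects_swap (u := rcons u i) (v := v) HN jk.
rewrite !cat_rcons in E1 E4 *.
rewrite E1 ?E2 ?E3 ?E4 ?(ltn_trans lt2) ?(ltn_trans lt4) //.
rewrite !(respects_ad _ _ HNs ltC).
rewrite -(br_jacobi brP e`_i e`_j e`_k) with_letterD.
by rewrite [LHS](AC (((1*2)*1)*2) (((1*5)*(4*(6*3)))*2)).
Qed.

Lemma cons_nseq (i : 'I_n) a s : i :: nseq a i ++ s = nseq a i ++ i :: s.
Proof. by elim: a => //= a ->. Qed.

Lemma rcons_nseq (i : 'I_n) a : rcons (nseq a i) i = nseq a.+1 i.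
Proof. by elim: a => //= a ->. Qed.

(** [q i] commutes with [e`_i], since ad(e_i)^p e_i = 0.  This settles the
    overlap of two occurrences of the p-th power of the same letter. *)
Lemma power_letter_slide N d (i : 'I_n) a u v :
    respects pbw_rew N (fun w => size w < d)%N -> (size u + a + size v + 1 < d)%N ->
  with_letter N u (q i) (nseq a i ++ v) = with_letter N (u ++ nseq a i) (q i) v.
Proof.
move=> HN; elim: a u => [|a IH] u ltd; first by rewrite cats0.
rewrite /= (respects_ad _ _ HN); last by rewrite size_cat size_nseq; lia.
have -> : br (q i) e`_i = 0.
  rewrite q_ad -(prednK (ltnW p_gt1)) iterSr br_alt //.
  by elim: p.-1 => //= m ->; rewrite br0r.
rewrite with_letter0 addr0 IH; last by rewrite size_rcons; lia.
by rewrite cat_rcons.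
Qed.

Lemma power_commutator_sum N d (i : 'I_n) c u v :
    respects pbw_rew N (fun w => size w < d)%N -> (size u + size v + p < d)%N ->
  \sum_(a < p) with_letter N (u ++ nseq a i) c (nseq (p.-1 - a) i ++ v) =
  with_letter N u (iter p.-1 (br e`_i) c) v.
Proof.
move=> HN ltd.
have /= := iter_ad_sum hp (D := br e`_i)
  (X := fun a b c => with_letter N (u ++ nseq a i) c (nseq b i ++ v)) _ c.
rewrite cats0 => -> => [|a b x ab]; last first.
  rewrite [X in _ - X](respects_ad _ _ HN); last first.
    by rewrite !size_cat !size_nseq; lia.
  rewrite rcons_cat rcons_nseq opprD addrA subrr add0r -with_letterN.
  by rewrite (br_anti brP).
rewrite (reindex_inj rev_ord_inj) /=; apply: eq_bigr => k _.
have -> : (p - k.+1 = p.-1 - k)%N by lia.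
by rewrite subKn // -ltnS (prednK (ltnW p_gt1)).
Qed.

Lemma word_rank_slide (i j : 'I_n) a b m u v : (j < i)%N ->
  (word_rank (u ++ nseq a i ++ j :: nseq (m.+1 + b) i ++ v) <
   word_rank (u ++ nseq (a + m.+1) i ++ j :: nseq b i ++ v))%N.
Proof.
move=> ji; elim: m a => [|m IH] a.
  rewrite addn1 -rcons_nseq cat_rcons !catA add1n /=.
  exact: word_rank_swap.
rewrite addnS -addSn; apply: ltn_trans (IH a.+1).
rewrite -[nseq a.+1 i]rcons_nseq cat_rcons !catA addSn /=.
exact: word_rank_swap.
Qed.

(** Sorting e_i^p e_j from the right moves e_j through the p letters e_i and
    leaves the sum of the e_i^a [e_i, e_j] e_i^(p-1-a), which equals
    ad(e_i)^(p-1) [e_i, e_j] = [q_i, e_j]; rewriting the power first leaves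
    q_i e_j = e_j q_i + [q_i, e_j]. *)
Lemma overlap_pow_swap N (i j : 'I_n) u v : (j < i)%N ->
    respects pbw_rew N
      (fun w => word_rank w < word_rank (u ++ nseq p i ++ j :: v))%N ->
  with_letter N u (q i) (j :: v) =
  N ((u ++ nseq p.-1 i) ++ [:: j, i & v]) +
    with_letter N (u ++ nseq p.-1 i) (br e`_i e`_j) v.
Proof.
move=> ji HN; have HNs := respects_rank_size HN.
have p0 : p = p.-1.+1 by rewrite (prednK (ltnW p_gt1)).
pose f a := with_letter N (u ++ nseq a i) (br e`_i e`_j) (nseq (p.-1 - a) i ++ v).
(* The p-th passage of e_j, starting from the full word, is the right-hand side
   of the goal; the others concern words of smaller rank. *)
have step m : (m < p)%N ->
    N (u ++ nseq m i ++ j :: nseq (p - m) i ++ v) =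
    N (u ++ j :: nseq p i ++ v) + \sum_(0 <= a < m) f a.
  elim: m => [|m IH] mp; first by rewrite big_nil addr0 subn0.
  rewrite big_nat_recr //= addrA -IH ?(ltnW mp) // /f.
  have -> : (p - m = (p.-1 - m).+1)%N by lia.
  have -> : (p - m.+1 = p.-1 - m)%N by lia.
  rewrite (cons_nseq i m) !catA; apply: (respects_swap HN ji).
  have := @word_rank_slide i j m.+1 0 (p - m.+2) u v ji.
  have -> : ((p - m.+2).+1 + 0 = p.-1 - m)%N by lia.
  have -> : (m.+1 + (p - m.+2).+1 = p)%N by lia.
  by rewrite /= (cons_nseq i m) !catA.
have := step p.-1; rewrite -p0 => /(_ (leqnn _)).
have -> : (p - p.-1 = 1)%N by lia.
rewrite -catA => ->; rewrite -addrA.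
have -> : with_letter N (u ++ nseq p.-1 i) (br e`_i e`_j) v = f p.-1.
  by rewrite /f subnn.
rewrite -(big_nat_recr p.-1 0 f (leq0n _)) -p0 big_mkord.
rewrite (power_commutator_sum _ _ HNs).
- rewrite -iterSr -p0 -q_ad -cat_rcons (respects_pow HN) ?cat_rcons.
    by rewrite (respects_ad _ _ HNs) // !size_cat size_nseq /=; lia.
  have := @word_rank_slide i j 0 0 p.-1 u v ji.
  by rewrite -p0 add0n addn0 /=.
by rewrite !size_cat size_nseq /=; lia.
Qed.

Lemma respects_slide N P (i k : 'I_n) a b u v : (i < k)%N ->
    respects pbw_rew N P -> P (u ++ nseq a i ++ k :: nseq b.+1 i ++ v) ->
  N (u ++ nseq a i ++ k :: nseq b.+1 i ++ v) =
  N (u ++ nseq a.+1 i ++ k :: nseq b i ++ v) +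
    with_letter N (u ++ nseq a i) (br e`_k e`_i) (nseq b i ++ v).
Proof.
move=> ik HN; rewrite [nseq a.+1 i ++ _]/= (cons_nseq i a) !catA.
exact: respects_swap HN ik.
Qed.

Lemma word_rank_slide_up (i k : 'I_n) a b m u v : (i < k)%N ->
  (word_rank (u ++ nseq (a + m.+1) i ++ k :: nseq b i ++ v) <
   word_rank (u ++ nseq a i ++ k :: nseq (m.+1 + b) i ++ v))%N.
Proof.
move=> ik; have step a' b' :
    (word_rank (u ++ nseq a'.+1 i ++ k :: nseq b' i ++ v) <
     word_rank (u ++ nseq a' i ++ k :: nseq b'.+1 i ++ v))%N.
  rewrite [nseq a'.+1 i ++ _]/= (cons_nseq i a') !catA.
  exact: word_rank_swap.
elim: m a => [|m IH] a; first by rewrite addn1.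
by rewrite addnS -addSn; apply: ltn_trans (IH a.+1) (step _ _).
Qed.

(** The mirror image of [overlap_pow_swap], for e_k e_i^p with i < k. *)
Lemma overlap_swap_pow N (i k : 'I_n) u v : (i < k)%N ->
    respects pbw_rew N
      (fun w => word_rank w < word_rank (u ++ k :: nseq p i ++ v))%N ->
  N (u ++ [:: i, k & nseq p.-1 i ++ v]) +
    with_letter N u (br e`_k e`_i) (nseq p.-1 i ++ v) =
  with_letter N (rcons u k) (q i) v.
Proof.
move=> ik HN; have HNs := respects_rank_size HN.
have p0 : p = p.-1.+1 by rewrite (prednK (ltnW p_gt1)).
have lower a : (a < p)%N ->
    (word_rank (u ++ nseq a.+1 i ++ k :: nseq (p.-1 - a) i ++ v)
      < word_rank (u ++ k :: nseq p i ++ v))%N.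
  move=> ap; have := word_rank_slide_up 0 (p.-1 - a) a u v ik.
  by have -> : (a.+1 + (p.-1 - a) = p)%N by lia.
pose f a := with_letter N (u ++ nseq a i) (br e`_k e`_i) (nseq (p.-1 - a) i ++ v).
(* Here the first passage of e_k is the left-hand side of the goal. *)
have step m : (m < p)%N ->
    N (u ++ [:: i, k & nseq p.-1 i ++ v]) + f 0%N =
    N (u ++ nseq m.+1 i ++ k :: nseq (p.-1 - m) i ++ v) + \sum_(0 <= a < m.+1) f a.
  elim: m => [|m IH] mp; first by rewrite big_nat1 subn0.
  rewrite IH ?(ltnW mp) // [in RHS]big_nat_recr // addrA [RHS]addrAC.
  congr (_ + _).
  have e1 : (p.-1 - m = (p.-1 - m.+1).+1)%N by lia.
  rewrite e1; apply: (respects_slide ik HN).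
  by rewrite -e1; apply: lower (ltnW mp).
have -> : with_letter N u (br e`_k e`_i) (nseq p.-1 i ++ v) = f 0%N.
  by rewrite /f subn0 cats0.
rewrite (step p.-1) -?p0 // subnn big_mkord (power_commutator_sum _ _ HNs).
  rewrite (respects_pow HN) /=; last first.
    by have := lower p.-1; rewrite -p0 subnn /=; apply.
  rewrite (respects_ad _ _ HNs); last by rewrite size_cat /= size_cat size_nseq; lia.
  rewrite q_ad -addrA -with_letterD [br e`_k e`_i](br_anti brP).
  suff -> : iter p.-1 (br e`_i) (- br e`_i e`_k) = - iter p (br e`_i) e`_k.
    by rewrite subrr with_letter0 addr0.
  rewrite [in RHS]p0 iterSr; elim: p.-1 => //= m ->.
  by rewrite brNr.
by rewrite size_cat /= size_cat size_nseq; lia.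
Qed.

Lemma nseq_cat_split (i : 'I_n) a m s v : nseq a i ++ v = m ++ s ->
  (size m < a)%N -> m = nseq (size m) i /\ s = i :: nseq (a - size m).-1 i ++ v.
Proof.
elim: a m => [|a IH] [|x m] //=.
case=> <- E; rewrite ltnS => /(IH _ E)[<- ->].
by rewrite subSS.
Qed.

Lemma pbw_overlap N u l v m l' v' r r' :
    respects pbw_rew N (fun w => word_rank w < word_rank (u ++ l ++ v))%N ->
    pbw_rew l = Some r -> pbw_rew l' = Some r' ->
    l ++ v = m ++ l' ++ v' -> (size m < size l)%N ->
  rew_at N r u v = rew_at N r' (u ++ m) v'.
Proof.
have p0 : p = p.-2.+2 by have := p_gt1; lia.
move=> HN /pbw_rewP rl /pbw_rewP rl'; case: rl HN => [i j ij|i] HN.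
- case: rl' => [i' j' ij'|i'] /=; last first.
    rewrite {1}p0; case: m => [|x [|y m]] //= [].
      by move=> ej ei _; move: ij; rewrite ej ei ltnn.
    move=> <- ei ev _; rewrite ei in ij HN *.
    have {}ev : v = nseq p.-1 i' ++ v' by rewrite ev [in RHS]p0.
    rewrite rew_at_swap rew_at_letters cats1 ev; apply: overlap_swap_pow ij _.
    by move: HN; rewrite ev /= -cat_cons -[i' :: _]/(nseq p.-1.+1 i') (prednK (ltnW p_gt1)).
  case: m => [|x [|y m]] //= [].
    by move=> <- <- <- _; rewrite cats0.
  move=> <- ej ev _; rewrite -ej {j' ej} in ij' *.
  by rewrite ev in HN *; rewrite !rew_at_swap cats1; apply: overlap_swap_swap.
rewrite size_nseq => E ltm; case: (nseq_cat_split E ltm) => em E1.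
case: rl' E E1 => [i' j' ij'|i'] E E1.
  case: (posnP (p - size m).-1) E1 => [p1|].
    have sm : size m = p.-1 by lia.
    rewrite p1 /= => -[ej ei]; rewrite ej sm in ij' em *; rewrite em -ei.
    rewrite rew_at_letters rew_at_swap; apply: overlap_pow_swap ij' _.
    by rewrite ei.
  by case: (p - size m).-1 => //= b _ [ej ei]; rewrite ej ei ltnn in ij'.
have ei : i' = i by move: E1; rewrite {1}p0 => -[].
rewrite ei in E; rewrite ei !rew_at_letters.
have ev : v = nseq (size m) i ++ v'.
  move/(congr1 (drop p)): E.
  rewrite drop_size_cat ?size_nseq // => ->.
  by rewrite {1}em catA -nseqD addnC nseqD -catA drop_size_cat ?size_nseq.
have sv := congr1 size ev; rewrite size_cat size_nseq in sv.
rewrite ev [in RHS]em (power_letter_slide _ (respects_rank_size HN)) //.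
by rewrite !size_cat size_nseq sv; lia.
Qed.

End Confluence.

(** * The Poincare-Birkhoff-Witt module *)

Lemma irreducible_suffix u w :
  irreducible pbw_rew (u ++ w) -> irreducible pbw_rew w.
Proof. by move=> irr a l b ew; apply: (irr (u ++ a) l b); rewrite ew !catA. Qed.

Lemma irreducible_sorted w :
  irreducible pbw_rew w -> sorted (fun i j : 'I_n => (i <= j)%N) w.
Proof.
elim: w => //= i [|j w] IH irr //=.
have -> : (i <= j)%N.
  case: leqP => // ji; have := irr [::] [:: i; j] w erefl.
  by rewrite pbw_rew_swap.
exact: IH (@irreducible_suffix [:: i] _ irr).
Qed.

Lemma irreducible_pow (i : 'I_n) a w :
  irreducible pbw_rew (nseq a i ++ w) -> (a < p)%N.
Proof.
move=> irr; case: ltnP => // pa.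
have := irr [::] (nseq p i) (nseq (a - p) i ++ w).
by rewrite cat0s catA -nseqD subnKC // pbw_rew_pow => /(_ erefl).
Qed.

Lemma path_ordS (i : 'I_n) w : path (fun i j : 'I_n => (i <= j)%N) i w ->
  exists a w', w = nseq a i ++ w' /\ all (fun j : 'I_n => (i < j)%N) w'.
Proof.
elim: w => [|j w IH] /=; first by exists 0%N, [::].
case/andP; rewrite leq_eqVlt => /predU1P[/ord_inj <-|ij] pw.
  by have [a [w' [-> all_w']]] := IH pw; exists a.+1, w'.
exists 0%N, (j :: w); split; rewrite //= ij.
have trans : transitive (fun i j : 'I_n => (i <= j)%N).
  by move=> y x z; apply: leq_trans.
by apply: sub_all (order_path_min trans pw) => k; apply: leq_trans.
Qed.

(** An irreducible word is sorted and contains each letter fewer than p times.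
    The bound makes the module of normal forms finite-dimensional. *)
Lemma irreducible_size w : irreducible pbw_rew w -> (size w <= n * p)%N.
Proof.
suff H m : forall w, irreducible pbw_rew w ->
    all (fun j : 'I_n => n <= j + m)%N w -> (size w <= m * p)%N.
  by move=> irr; apply: H => //; apply/allP => j _; apply: leq_addl.
elim: m => [|m IH] {}w irr.
  by case: w irr => [|i w] //= _ /andP[]; rewrite addn0 leqNgt ltn_ord.
case: w irr => [|i w] // irr /= /andP[im _].
have [a [w' [ew all_w']]] := path_ordS (irreducible_sorted irr).
rewrite ew in irr *; have ap := @irreducible_pow i a.+1 w' irr.
rewrite size_cat size_nseq mulSn -addSn leq_add ?(ltnW ap) //.
apply: IH; first exact: (@irreducible_suffix (nseq a.+1 i)).
by apply: sub_all all_w' => j; lia.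
Qed.

(** The space has one basis vector for each word of length at most n p, reducible
    or not.  The reducible ones are harmless: the action sends the basis vector
    of w to the normal form of a letter followed by w, and the relations hold
    for all words w. *)
Notation bword := ((n * p).-bseq 'I_n).

Definition pbw_space : vectType F := {ffun bword -> F^o}.

Definition word_vec (w : seq 'I_n) : pbw_space := [ffun t : bword => (t == w :> seq _)%:R].

Definition pbw_nf := nf pbw_rew (@word_rank n) word_vec.

Lemma pbw_nf_respects : respects pbw_rew pbw_nf predT.
Proof.
apply: nf_respects; first exact: pbw_rank.
by move=> N *; apply: pbw_overlap; eassumption.
Qed.

Lemma pbw_nf_rew u l v r : pbw_rew l = Some r ->
  pbw_nf (u ++ l ++ v) = rew_at pbw_nf r u v.
Proof. by move=> rl; apply: pbw_nf_respects. Qed.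

Lemma pbw_nf_irreducible w : irreducible pbw_rew w -> pbw_nf w = word_vec w.
Proof. exact: (nf_irreducible pbw_rank). Qed.

Definition pbw_act_fun (x : g) (f : pbw_space) : pbw_space :=
  \sum_t f t *: with_letter pbw_nf [::] x t.

Lemma pbw_act_fun_linear x : linear (pbw_act_fun x).
Proof.
move=> a f f'; rewrite /pbw_act_fun scaler_sumr -big_split; apply: eq_bigr => t _.
by rewrite !ffunE scalerDl scalerA.
Qed.

HB.instance Definition _ x := GRing.isSemilinear.Build F pbw_space pbw_space _
  (pbw_act_fun x) (GRing.semilinear_linear (pbw_act_fun_linear x)).

Definition pbw_act (x : g) : 'End(pbw_space) := linfun (pbw_act_fun x).

Lemma pbw_actE x f : pbw_act x f = \sum_t f t *: with_letter pbw_nf [::] x t.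
Proof. by rewrite lfunE. Qed.

Lemma pbw_act_linear : linear pbw_act.
Proof.
move=> a x y; apply/lfunP => f; rewrite add_lfunE scale_lfunE !pbw_actE.
rewrite scaler_sumr -big_split; apply: eq_bigr => t _.
by rewrite with_letterD with_letterZ scalerDr !scalerA mulrC.
Qed.

Lemma word_ind (P : seq 'I_n -> Prop) :
    (forall w, irreducible pbw_rew w -> P w) ->
    (forall u l v r, pbw_rew l = Some r ->
       (forall cx, cx \in r -> P (u ++ cx.2 ++ v)) -> P (u ++ l ++ v)) ->
  forall w, P w.
Proof.
move=> Pirr Pred w; have [k] := ubnP (word_rank w).
elim: k w => // k IH w /ltnSE wk.
have [/Pirr //|[u [l [v [r [ew rl]]]]]] := reducible_dec pbw_rew w.
move: wk; rewrite ew => wk; apply: (Pred _ _ _ _ rl) => cx cxr; apply: IH.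
exact: leq_trans (pbw_rank _ _ rl cxr) wk.
Qed.

(** Left multiplication is compatible with normal forms, because rewriting inside
    w is also a rewriting of a letter followed by w. *)
Lemma pbw_act_nf x w : pbw_act x (pbw_nf w) = with_letter pbw_nf [::] x w.
Proof.
elim/word_ind: w => [w irr|u l v r rl IH].
  rewrite pbw_nf_irreducible // pbw_actE.
  have szw : (size w <= n * p)%N := irreducible_size irr.
  rewrite (bigD1 (Bseq szw)) //= ffunE eqxx scale1r big1 ?addr0 // => t.
  rewrite -val_eqE /= => /negbTE tw.
  by rewrite ffunE tw scale0r.
rewrite (pbw_nf_rew u v rl) /rew_at linear_sum /=.
under eq_big_seq => cx cxr do rewrite linearZ /= IH //.
rewrite /with_letter.
under [RHS]eq_bigr => k _.
  rewrite cat0s -cat_cons (pbw_nf_rew (k :: u) v rl) /rew_at scaler_sumr.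
  over.
rewrite exchange_big /=; apply: eq_bigr => cx _; rewrite scaler_sumr.
by apply: eq_bigr => k _; rewrite !scalerA mulrC.
Qed.

Lemma pbw_act_letters x y w : pbw_act x (with_letter pbw_nf [::] y w) =
  with_letters pbw_nf [::] x y w.
Proof.
rewrite linear_sum /=.
under eq_bigr => k _ do rewrite linearZ /= pbw_act_nf.
rewrite /with_letters /with_letter.
under eq_bigr do rewrite scaler_sumr.
rewrite exchange_big /=; apply: eq_bigr => k _; rewrite scaler_sumr.
by apply: eq_bigr => l _; rewrite !scalerA mulrC.
Qed.

Lemma pbw_act_comp x y f : pbw_act x (pbw_act y f) =
  \sum_t f t *: with_letters pbw_nf [::] x y t.
Proof.
rewrite (pbw_actE y) linear_sum; apply: eq_bigr => t _.
by rewrite linearZ /= pbw_act_letters.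
Qed.

Lemma pbw_act_lie x y :
  pbw_act (br x y) = (pbw_act x \o pbw_act y)%VF - (pbw_act y \o pbw_act x)%VF.
Proof.
apply/lfunP => f; rewrite add_lfunE opp_lfunE !comp_lfunE !pbw_act_comp pbw_actE.
rewrite -sumrB; apply: eq_bigr => t _; rewrite -scalerBr; congr (_ *: _).
rewrite (@respects_commutator _ _ (size t).+3) ?addn2 //.
by move=> u l v r rl _; apply: pbw_nf_rew.
Qed.

Lemma pbw_act_pow (i : 'I_n) f : iter p (pbw_act e`_i) f = pbw_act (q i) f.
Proof.
have act_e m t : iter m (pbw_act e`_i) (pbw_nf t) = pbw_nf (nseq m i ++ t).
  by elim: m => //= m ->; rewrite pbw_act_nf with_letter_e.
have iter_sum m h : iter m.+1 (pbw_act e`_i) h =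
    \sum_t h t *: pbw_nf (nseq m.+1 i ++ t).
  elim: m h => [|m IH] h.
    by rewrite /= pbw_actE; apply: eq_bigr => t _; rewrite with_letter_e.
  rewrite iterS IH linear_sum; apply: eq_bigr => t _.
  by rewrite linearZ /= pbw_act_nf with_letter_e.
rewrite -(prednK (ltnW p_gt1)) iter_sum (prednK (ltnW p_gt1)) pbw_actE.
apply: eq_bigr => t _; congr (_ *: _); rewrite -[nseq p i ++ t]cat0s.
by rewrite (pbw_nf_rew [::] t (pbw_rew_pow i)) rew_at_letters.
Qed.

Definition nil_word : bword := @Bseq _ _ [::] (leq0n (n * p)).

Definition pbw_unit : pbw_space := word_vec [::].

(** The augmentation.  It vanishes on nonempty words, as no rule produces the
    empty word from a nonempty one. *)
Definition pbw_aug (f : pbw_space) : F^o := f nil_word.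

Lemma pbw_aug_linear : linear pbw_aug.
Proof. by move=> a f h; rewrite /pbw_aug !ffunE. Qed.

HB.instance Definition _ := GRing.isSemilinear.Build F pbw_space F^o _
  pbw_aug (GRing.semilinear_linear pbw_aug_linear).

Lemma pbw_rew_neq_nil u l v r : pbw_rew l = Some r ->
  forall cx, cx \in r -> u ++ cx.2 ++ v != [::].
Proof.
move=> rl cx cxr; have : cx.2 != [::].
  case: (pbw_rewP rl) cxr => [i j _|i] //=; last by case/mapP => k _ ->.
  by rewrite inE => /predU1P[->|/mapP[k _ ->]].
by case: cx.2 => // a s _; case: u.
Qed.

Lemma pbw_aug_nf w : w != [::] -> pbw_aug (pbw_nf w) = 0.
Proof.
elim/word_ind: w => [w irr w0|u l v r rl IH _].
  by rewrite pbw_nf_irreducible // /pbw_aug ffunE /= eq_sym (negbTE w0).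
rewrite (pbw_nf_rew u v rl) /rew_at linear_sum big1_seq //= => cx cxr.
by rewrite linearZ /= IH ?scaler0 //; apply: pbw_rew_neq_nil rl _ cxr.
Qed.

Lemma pbw_aug_act x f : pbw_aug (pbw_act x f) = 0.
Proof.
rewrite pbw_actE linear_sum big1 // => t _; rewrite linearZ /= linear_sum big1 ?scaler0 //.
by move=> k _; rewrite linearZ /= pbw_aug_nf ?scaler0.
Qed.

Lemma pbw_aug_unit : pbw_aug pbw_unit = 1.
Proof. by rewrite /pbw_aug ffunE eqxx. Qed.

Definition letter_part (f : pbw_space) : g :=
  \sum_(t : bword) f t *: (if val t is [:: k] then e`_k else 0).

Lemma letter_part_linear : linear letter_part.
Proof.
move=> a f h; rewrite /letter_part scaler_sumr -big_split; apply: eq_bigr => t _.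
by rewrite !ffunE scalerDl scalerA.
Qed.

HB.instance Definition _ := GRing.isSemilinear.Build F pbw_space g _
  letter_part (GRing.semilinear_linear letter_part_linear).

Lemma letter_part_word w : (size w <= n * p)%N ->
  letter_part (word_vec w) = if w is [:: k] then e`_k else 0.
Proof.
move=> szw; rewrite /letter_part (bigD1 (Bseq szw)) //= ffunE eqxx scale1r.
rewrite big1 ?addr0 // => t; rewrite -val_eqE /= => /negbTE tw.
by rewrite ffunE tw scale0r.
Qed.

Lemma irreducible_small w : (size w < 2)%N -> irreducible pbw_rew w.
Proof.
move=> szw u l v ew; case rl: (pbw_rew l) => [r|] //.
have : (1 < size l)%N by case: (pbw_rewP rl) => // i; rewrite size_nseq.
by move: szw; rewrite ew !size_cat; lia.
Qed.

Lemma letter_part_act x : letter_part (pbw_act x pbw_unit) = x.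
Proof.
rewrite /pbw_unit -pbw_nf_irreducible; last exact: irreducible_small.
rewrite pbw_act_nf linear_sum [RHS]coord_sum; apply: eq_bigr => k _.
rewrite linearZ /= pbw_nf_irreducible; last exact: irreducible_small.
by rewrite letter_part_word // irreducible_size //; apply: irreducible_small.
Qed.

(** If the first letters commute and have p-th power 0, a word that starts with
    one of them rewrites only into words of length at least two that again start
    with one of them: the rules that shorten the word at its beginning
    contribute 0. *)
Section AbelianInitialSegment.

Variable m : nat.
Hypothesis abelian_m : forall i j : 'I_n, (i < m)%N -> (j < m)%N -> br e`_i e`_j = 0.
Hypothesis q_m : forall i : 'I_n, (i < m)%N -> q i = 0.

Lemma letter_part_long (i : 'I_n) w : (i < m)%N -> w != [::] ->
  letter_part (pbw_nf (i :: w)) = 0.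
Proof.
move=> im w0; have [iw] : {iw | iw = i :: w} by exists (i :: w).
move=> eiw; rewrite -eiw.
elim/word_ind: iw i w im w0 eiw => [w irr|u l v r rl IH] i w' im w0 ew.
  rewrite pbw_nf_irreducible // letter_part_word ?irreducible_size //.
  by rewrite ew; case: (w') w0.
rewrite (pbw_nf_rew u v rl); case: u IH ew => [|i1 u] IH ew; last first.
  rewrite /rew_at linear_sum big1_seq //= => cx cxr; rewrite linearZ /=.
  have ei : i1 = i by case: ew.
  rewrite (IH cx cxr i1 (u ++ cx.2 ++ v)) ?scaler0 ?ei //.
  exact: pbw_rew_neq_nil rl _ cxr.
case: (pbw_rewP rl) IH ew => [i1 j1 lt|i1] IH ew.
  case: ew => ej _; rewrite ej in lt *.
  rewrite rew_at_swap abelian_m ?(ltn_trans lt) // with_letter0 addr0.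
  rewrite -ej; apply: (IH (1, [:: i1; j1]) _ i1 (j1 :: v)) => //.
    by rewrite inE eqxx.
  exact: ltn_trans lt im.
have ei : i1 = i by move: ew; rewrite -(prednK (ltnW p_gt1)) => -[].
by rewrite rew_at_letters q_m ?ei // with_letter0 linear0.
Qed.

Lemma letter_part_act_aug0 (i : 'I_n) f : (i < m)%N -> pbw_aug f = 0 ->
  letter_part (pbw_act e`_i f) = 0.
Proof.
move=> im f0; rewrite pbw_actE linear_sum big1 // => t _.
rewrite linearZ /= with_letter_e.
have [->|tn] := eqVneq t nil_word; first by rewrite [f _]f0 scale0r.
by rewrite letter_part_long ?scaler0.
Qed.

End AbelianInitialSegment.

(** A form of the restricted Poincare-Birkhoff-Witt theorem.  In the module
    spanned by normal words, [w1] is the empty word, [aug] its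
    coefficient and [part1] the component in degree one. *)
Theorem pbw_module : exists (W : vectType F) (act : {linear g -> 'End(W)})
    (w1 : W) (aug : {linear W -> F^o}) (part1 : {linear W -> g}),
  [/\ forall x y, act (br x y) = (act x \o act y)%VF - (act y \o act x)%VF,
      forall (i : 'I_n) w, iter p (act e`_i) w = act (q i) w,
      aug w1 = 1 /\ forall x w, aug (act x w) = 0,
      forall x, part1 (act x w1) = x
    & forall m, (forall i j : 'I_n, (i < m)%N -> (j < m)%N -> br e`_i e`_j = 0) ->
        (forall i : 'I_n, (i < m)%N -> q i = 0) ->
      forall (i : 'I_n) w, (i < m)%N -> aug w = 0 -> part1 (act e`_i w) = 0].
Proof.
pose act : {linear g -> 'End(pbw_space)} :=
  HB.pack pbw_act (GRing.isSemilinear.Build F g 'End(pbw_space) _ pbw_act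
    (GRing.semilinear_linear pbw_act_linear)).
exists pbw_space, act, pbw_unit, pbw_aug, letter_part; split.
- exact: pbw_act_lie.
- exact: pbw_act_pow.
- by split; [exact: pbw_aug_unit | exact: pbw_aug_act].
- exact: letter_part_act.
exact: letter_part_act_aug0.
Qed.

End PBWRules.

(** * Jacobson's formula *)

Section JacobsonFormula.

Variables (F : fieldType) (p : nat) (hp : p \in [pchar F]).
Variables (g : vectType F) (br : g -> g -> g) (A : algType F).
Variable f : {linear g -> A}.
Hypothesis f_lie : forall x y, f (br x y) = f x * f y - f y * f x.
Variables x y : g.

Let a := f x.
Let b := f y.

(** The polynomial t a + b, with t a central variable. *)
Let X : {poly A} := a%:P * 'X + b%:P.
Let adX (Q : {poly A}) : {poly A} := X * Q - Q * X.

Lemma coef_mulX Q i : (X * Q)`_i = (if i is i'.+1 then a * Q`_i' else 0) + b * Q`_i.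
Proof.
rewrite mulrDl coefD coefCM -mulrA -commr_polyX mulrA coefMX.
by case: i => //= i; rewrite coefCM.
Qed.

Lemma coef_Xmul Q i : (Q * X)`_i = (if i is i'.+1 then Q`_i' * a else 0) + Q`_i * b.
Proof.
rewrite mulrDr coefD coefMC mulrA coefMX.
by case: i => //= i; rewrite coefMC.
Qed.

Lemma coef_iter_ad m i : (iter m adX a%:P)`_i = f (ad_coef br x y m i).
Proof.
elim: m i => [|m IH] i /=; first by rewrite coefC; case: i; rewrite ?linear0.
rewrite coefB coef_mulX coef_Xmul [f (_ + _)]linearD f_lie.
case: i => [|i]; rewrite !IH; first by rewrite !add0r linear0 addr0.
by rewrite f_lie opprD addrACA addrC.
Qed.

(** The sum equals ad(t a + b)^(p-1)(a) when m = p, which identifies i times the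
    i-th coefficient of (t a + b)^p. *)
Lemma deriv_exp m :
  (X ^+ m)^`() = \sum_(k < m) X ^+ (m.-1 - k) * a%:P * X ^+ k.
Proof.
elim: m => [|m IH]; first by rewrite expr0 derivC big_ord0.
rewrite exprS derivM IH big_ord_recr /= subnn mul1r addrC; congr (_ + _).
  by rewrite /X derivD derivC addr0 derivM derivX derivC mul0r add0r mulr1.
rewrite mulr_sumr; apply: eq_bigr => k _; rewrite !mulrA -exprS.
by congr (_ ^+ _ * _ * _); have := ltn_ord k; lia.
Qed.

Lemma coef_exp_mid i : (0 < i < p)%N ->
  (X ^+ p)`_i = f (jacobson_s br p x y i).
Proof.
case: i => // i /= ip.
have i0 : i.+1%:R != 0 :> F by rewrite -(dvdn_pcharf hp) gtnNdvd.
rewrite /jacobson_s linearZ /=; apply: (scalerI i0); rewrite scalerA mulfV // scale1r.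
rewrite scaler_nat -coef_deriv deriv_exp coef_sum -coef_iter_ad.
have /= := iter_ad_sum hp (D := adX)
  (X := fun m k c => (X ^+ m * c * X ^+ k)`_i) _ a%:P.
rewrite mul1r mulr1 => -> // m k c _.
by rewrite -coefB; congr (_`_i); rewrite /adX mulrBr mulrBl exprSr exprS !mulrA.
Qed.

Lemma coef_exp_top m : (size (X ^+ m) <= m.+1)%N /\ (X ^+ m)`_m = a ^+ m.
Proof.
elim: m => [|m [IHs IHc]]; first by rewrite size_poly1 coef1.
split; last by rewrite !exprS coef_mulX IHc (nth_default _ IHs) mulr0 addr0.
apply/leq_sizeP => -[|j] // mj; rewrite exprS coef_mulX.
by rewrite !nth_default ?mulr0 ?addr0 // (leq_trans IHs) // ltnW.
Qed.

Lemma coef_exp_bot m : (X ^+ m)`_0 = b ^+ m.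
Proof. by elim: m => [|m IH]; rewrite ?coef1 // !exprS coef_mulX add0r IH. Qed.

(** Evaluate (t a + b)^p at t = 1: the extreme coefficients are b^p and a^p, the
    others are given by [coef_exp_mid]. *)
Lemma jacobson_formula :
  (f x + f y) ^+ p = f x ^+ p + f y ^+ p + \sum_(1 <= i < p) f (jacobson_s br p x y i).
Proof.
have p1 := prime_gt1 (pcharf_prime hp).
have [szX topX] := coef_exp_top p.
have <- : X.[1] = f x + f y.
  by rewrite hornerD hornerC hornerMX hornerC mulr1.
rewrite -horner_exp_comm; last by rewrite /comm_poly mul1r mulr1.
rewrite (horner_coef_wide _ szX) -(big_mkord xpredT (fun i => (X ^+ p)`_i * 1 ^+ i)).
rewrite big_nat_recr // big_ltn ?(ltnW p1) //= !expr1n !mulr1 topX coef_exp_bot.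
under eq_big_nat => i ip do rewrite expr1n mulr1 coef_exp_mid //.
by rewrite addrC addrA.
Qed.

End JacobsonFormula.

(** * Modules over the restricted enveloping algebra *)

Section EndAlgebra.

Variables (F : fieldType) (V : vectType F) (V_proper : (0 < dim V)%N).

(** The endomorphisms of a nonzero space, with composition as product; the
    algebra has to be nontrivial, whence the condition on the dimension. *)
Definition end_ring : nzRingType := lfun_comp_nzRingType V_proper.

Definition end_lalg : lalgType F :=
  HB.pack 'End(V) end_ring
    (GRing.Lmodule_isLalgebra.Build F end_ring
       (fun k (x y : 'End(V)) => comp_lfunZl k x y)).

Definition end_alg : algType F :=
  HB.pack 'End(V) end_lalg
    (GRing.Lalgebra_isAlgebra.Build F end_lalg
       (fun k (x y : 'End(V)) => comp_lfunZr k x y)).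

Lemma end_alg_exp (f : end_alg) m (v : V) :
  (f ^+ m : 'End(V)) v = iter m (f : 'End(V)) v.
Proof.
elim: m v => [|m IH] v; first by rewrite expr0 id_lfunE.
by rewrite exprS [LHS]comp_lfunE IH.
Qed.

End EndAlgebra.

Lemma dim_gt0 (F : fieldType) (V : vectType F) (v : V) : v != 0 -> (0 < dim V)%N.
Proof.
move=> v0; rewrite -dimvf lt0n dimv_eq0; apply: contraNneq v0 => V0.
by rewrite -memv0 -V0 memvf.
Qed.

Lemma memv_prod_ind (F : fieldType) (A : falgType F) (P : A -> Prop)
    (U V : {vspace A}) :
    P 0 -> (forall k a b, P a -> P b -> P (k *: a + b)) ->
    (forall u v, u \in U -> v \in V -> P (u * v)) ->
  forall w, w \in (U * V)%VS -> P w.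
Proof.
move=> P0 Plin Pmul w; rewrite unlock => /coord_span ->.
elim/big_rec: _ => [//|i a _ Pa]; apply: Plin => //.
have lti : (i < size (allpairs *%R (vbasis U) (vbasis V)))%N.
  by rewrite size_allpairs !size_tuple.
have /allpairsP[[u v] /= [uU vV ->]] := mem_nth 0 lti.
by apply: Pmul; apply: vbasis_mem.
Qed.

Section EnvelopingAlgebra.

Variables (F : fieldType) (p : nat) (L : restrictedLieAlgebra F p).
Variables (U : falgType F) (iota : {linear L -> U}).
Hypothesis hU : restricted_enveloping iota.

(** The map L -> A into the subalgebra A generated by L extends to u(L) -> A.
    Followed by the inclusion it agrees with the identity on L, hence is the
    identity, so A is all of u(L). *)
Lemma iota_generates : agenv (limg (linfun iota)) = fullv.
Proof.
set A := agenv _.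
have iA x : iota x \in A.
  by apply: (subvP (sub_agenv _)); rewrite -[iota x]lfunE memv_img ?memvf.
have A1 : algid (agenv_aspace (limg (linfun iota))) = 1.
  by apply/eqP; rewrite algid_eq1 memvE sub1_agenv.
pose B : falgType F := subvs_of (agenv_aspace (limg (linfun iota))).
pose jota : {linear L -> B} := vsproj A \o iota.
have valj x : vsval (jota x) = iota x by rewrite vsprojK.
have [[iota_lie iota_p] univ] := hU.
have val_exp (b : B) m : vsval (b ^+ m) = vsval b ^+ m.
  elim: m => [|m IH]; first exact: A1.
  by rewrite !exprS -IH.
have jhom : restricted_hom jota.
  split=> [x y|x]; apply: val_inj.
    by rewrite [LHS]valj iota_lie -[iota x]valj -[iota y]valj.
  by rewrite [LHS]valj [RHS]val_exp valj iota_p.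
have [phi [phiE _]] := univ B jota jhom.
pose vphi (u : U) : U := vsval (phi u).
have vphi_lin : linear vphi by move=> a u v; rewrite /vphi !linearP.
have vphi_mul : monoid_morphism vphi.
  by split=> [|u v]; rewrite /vphi ?rmorph1 ?rmorphM //; apply: A1.
pose psi : {lrmorphism U -> U} := HB.pack vphi
  (GRing.isSemilinear.Build F U U _ vphi (GRing.semilinear_linear vphi_lin))
  (GRing.isMonoidMorphism.Build U U vphi vphi_mul).
have [chi [_ chi_uniq]] := univ U iota (conj iota_lie iota_p).
have psiE : psi =1 chi.
  by apply: chi_uniq => x; rewrite -[RHS]valj; congr vsval; exact: phiE.
have idE : (idfun : U -> U) =1 chi by apply: (chi_uniq (idfun : {lrmorphism U -> U})).
apply/vspaceP => u; rewrite memvf -[u]/(idfun u) idE -psiE.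
exact: subvsP.
Qed.

Lemma enveloping_ind (P : U -> Prop) :
    P 1 -> (forall k a b, P a -> P b -> P (k *: a + b)) ->
    (forall x a, P a -> P (iota x * a)) ->
  forall u, P u.
Proof.
move=> P1 Plin Pmul u.
have P0 : P 0 by have := Plin (-1) _ _ P1 P1; rewrite scaleN1r addNr.
have PX i : forall w, w \in (limg (linfun iota) ^+ i)%VS -> P w.
  elim: i => [|i IH] w.
    rewrite expv0 => /vlineP[k ->]; rewrite -[_ *: _]addr0; exact: Plin.
  rewrite expvSl; apply: memv_prod_ind => // _ v /memv_imgP[x _ ->] /IH Pv.
  by rewrite lfunE; apply: Pmul.
have : u \in agenv (limg (linfun iota)) by rewrite iota_generates memvf.
case/memv_sumP => us us_in ->; elim/big_rec: _ => // i a _ Pa.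
by rewrite -[us i]scale1r; apply: Plin => //; apply: PX (us_in i isT).
Qed.

Lemma extend_rep (V : vectType F) (v : V) (rho : {linear L -> 'End(V)}) :
    v != 0 ->
    (forall x y, rho (lie x y) = (rho x \o rho y)%VF - (rho y \o rho x)%VF) ->
    (forall x w, rho (Defs.pmap x) w = iter p (rho x) w) ->
  exists act : U -> 'End(V), extends_action iota rho act.
Proof.
move=> v0 rho_lie rho_p; have V_proper := dim_gt0 v0.
pose f : L -> end_alg V_proper := rho.
have f_lin : linear f by move=> a x y; rewrite /f linearP.
pose fl : {linear L -> end_alg V_proper} := HB.pack f
  (GRing.isSemilinear.Build F L (end_alg V_proper) _ f (GRing.semilinear_linear f_lin)).
have fhom : restricted_hom fl.
  split=> [x y|x]; first exact: rho_lie.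
  by apply/lfunP => w; rewrite end_alg_exp; apply: rho_p.
have [phi [phiE _]] := hU.2 _ fl fhom.
exists phi; split; last exact: phiE.
split; first by move=> a u w; rewrite linearP.
- exact: (rmorph1 phi).
exact: (rmorphM phi).
Qed.

End EnvelopingAlgebra.

Section ModuleTheory.

Variables (F : fieldType) (U : falgType F) (V : vectType F).
Variables (act : U -> 'End(V)) (actP : is_module act).

Lemma module_lin k a b v : act (k *: a + b) v = k *: act a v + act b v.
Proof. by case: actP => -> _ _; rewrite add_lfunE scale_lfunE. Qed.

Lemma module1 v : act 1 v = v.
Proof. by case: actP => _ -> _; rewrite id_lfunE. Qed.

Lemma moduleM a b v : act (a * b) v = act a (act b v).
Proof. by case: actP => _ _ ->; rewrite comp_lfunE. Qed.

Lemma module0 v : act 0 v = 0.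
Proof. by have := module_lin (-1) 0 0 v; rewrite !scaleN1r !addNr. Qed.

Lemma moduleZ k a v : act (k *: a) v = k *: act a v.
Proof. by have := module_lin k a 0 v; rewrite module0 !addr0. Qed.

Lemma module_sum I (s : seq I) (P : pred I) (f : I -> U) v :
  act (\sum_(i <- s | P i) f i) v = \sum_(i <- s | P i) act (f i) v.
Proof.
apply: (big_morph (fun a => act a v)) => [a b|]; last exact: module0.
by have := module_lin 1 a b v; rewrite !scale1r.
Qed.

End ModuleTheory.

(** * Blocks and central idempotents *)

Section BlockTheory.

Variables (F : fieldType) (U : falgType F).

(** Split as long as some summand is decomposable; the dimensions decrease.
    Directness of the sum is recorded as additivity of the dimension. *)
Lemma ideal_decomposition (B : {vspace U}) : two_sided_ideal B ->
  exists s : seq {vspace U},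
    [/\ forall C, C \in s -> indecomposable_ideal C,
        (\sum_(C <- s) C)%VS = B & (\sum_(C <- s) \dim C = \dim B)%N].
Proof.
have [k] := ubnP (\dim B); elim: k B => // k IH B /ltnSE dB idB.
have [B0|B0] := eqVneq B 0%VS.
  by exists [::]; rewrite !big_nil B0 dimv0.
have [indB|nindB] := Classical_Prop.classic (indecomposable_ideal B).
  exists [:: B]; rewrite !big_seq1; split=> // C.
  by rewrite inE => /eqP ->.
have [B1 [B2 [id1 id2 e12 c12 [n1 n2]]]] : exists B1 B2 : {vspace U},
    [/\ two_sided_ideal B1, two_sided_ideal B2, (B1 + B2 = B)%VS,
        (B1 :&: B2 = 0)%VS & B1 != 0%VS /\ B2 != 0%VS].
  apply: Classical_Prop.NNPP => none; apply: nindB; split=> //; first exact/eqP.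
  move=> B1 B2 id1 id2 e12 c12.
  have [->|n1] := eqVneq B1 0%VS; first by left.
  have [->|n2] := eqVneq B2 0%VS; first by right.
  by case: none; exists B1, B2.
have dd := dimv_disjoint_sum c12; rewrite e12 in dd.
have d1 : (0 < \dim B1)%N by rewrite lt0n dimv_eq0.
have d2 : (0 < \dim B2)%N by rewrite lt0n dimv_eq0.
have [|s1 [ind1 sum1 dim1]] := IH B1 _ id1; first by lia.
have [|s2 [ind2 sum2 dim2]] := IH B2 _ id2; first by lia.
exists (s1 ++ s2); rewrite !big_cat /= sum1 sum2 dim1 dim2; split=> // C.
by rewrite mem_cat => /orP[/ind1|/ind2].
Qed.

Lemma block_decomposition_exists :
  exists (r : nat) (Bs : 'I_r -> {vspace U}), block_decomposition Bs.
Proof.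
have [|s [ind_s sum_s dim_s]] := @ideal_decomposition fullv.
  by split; apply: subvf.
exists (size s), (fun i => nth 0%VS s i).
have sumE : (\sum_(i < size s) nth 0%VS s i)%VS = fullv.
  by rewrite -sum_s (big_nth 0%VS) big_mkord.
split=> // [i|]; first exact/ind_s/mem_nth.
by rewrite directvE /= sumE -dim_s (big_nth 0%VS) big_mkord.
Qed.

Variables (r : nat) (Bs : 'I_r -> {vspace U}) (hB : block_decomposition Bs).

Lemma block_mull i u b : b \in Bs i -> u * b \in Bs i.
Proof.
move=> bB; have [/(_ i)[[idl _] _ _] _ _] := hB.
by apply: (subvP idl); apply: memv_mul; rewrite ?memvf.
Qed.

Lemma block_mulr i u b : b \in Bs i -> b * u \in Bs i.
Proof.
move=> bB; have [/(_ i)[[_ idr] _ _] _ _] := hB.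
by apply: (subvP idr); apply: memv_mul; rewrite ?memvf.
Qed.

Lemma block_ortho i k b c : i != k -> b \in Bs i -> c \in Bs k -> b * c = 0.
Proof.
move=> ik bB cB; have [_ dir _] := hB.
have /directv_sumP/(_ i isT) cap0 := dir.
apply/eqP; rewrite -memv0 -cap0 memv_cap block_mulr //=.
apply: (subvP (sumv_sup k _ (subvv _))); first by rewrite eq_sym.
exact: block_mull.
Qed.

(** The component e i of 1 is a two-sided unit of the block Bs i, as different
    blocks annihilate each other; hence e i u = e i u e i = u e i. *)
Lemma block_idempotents : exists e : 'I_r -> U,
  [/\ forall i, e i \in Bs i, \sum_i e i = 1 & forall i u, e i * u = u * e i].
Proof.
have [_ _ full] := hB.
have : 1 \in (\sum_i Bs i)%VS by rewrite full memvf.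
case/memv_sumP => e e_in sum_e.
have idl i b : b \in Bs i -> e i * b = b.
  move=> bB; rewrite -[RHS]mul1r sum_e mulr_suml (bigD1 i) //= big1 ?addr0 //.
  by move=> k ki; apply: (block_ortho ki) bB; apply: e_in.
have idr i b : b \in Bs i -> b * e i = b.
  move=> bB; rewrite -[RHS]mulr1 sum_e mulr_sumr (bigD1 i) //= big1 ?addr0 //.
  by move=> k ki; rewrite eq_sym in ki; apply: (block_ortho ki bB); apply: e_in.
exists e; split=> [i||i u]; [exact: e_in | by [] |].
have eB := e_in i isT.
by rewrite -[LHS](idr i) ?block_mulr // -[RHS](idl i) ?block_mull // mulrA.
Qed.

(** The images of the central idempotents are submodules, and they cannot all
    vanish because the idempotents add up to 1.  A full image of e i excludes the
    action of every other block. *)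
Lemma irreducible_in_block (V : vectType F) (act : U -> 'End(V)) (v : V) :
    is_module act -> v != 0 ->
    (forall W : {vspace V}, (forall u, act u @: W <= W)%VS -> W <> 0%VS ->
       W = fullv) ->
  exists i, in_block Bs i act.
Proof.
move=> actP v0 irr.
have [e [e_in sum_e e_central]] := block_idempotents.
have [i Wi] : exists i, act (e i) v != 0.
  apply/existsP; apply: contraNT v0 => /existsPn zero.
  rewrite -[v](module1 actP) -sum_e module_sum // big1 // => i _.
  by have := zero i; rewrite negbK => /eqP.
have full : limg (act (e i)) = fullv.
  apply: irr => [u|W0].
    apply/subvP => _ /memv_imgP[_ /memv_imgP[w _ ->] ->].
    by rewrite -moduleM // -e_central moduleM // memv_img ?memvf.
  by case/negP: Wi; rewrite -memv0 -W0 memv_img ?memvf.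
exists i; split=> [|k ki c cB].
  apply/vspaceP => w; rewrite memvf.
  have : w \in limg (act (e i)) by rewrite full memvf.
  case/memv_imgP => w' _ ->; rewrite (coord_vbasis (e_in i)) module_sum //.
  apply: rpred_sum => j _; rewrite moduleZ //; apply: rpredZ.
  have bj : (vbasis (Bs i))`_j \in vbasis (Bs i) by apply: memt_nth.
  rewrite (big_rem _ bj) /=; apply: (subvP (addvSl _ _)).
  by rewrite memv_img ?memvf.
apply/lfunP => w; rewrite zero_lfunE.
have : w \in limg (act (e i)) by rewrite full memvf.
case/memv_imgP => w' _ ->; rewrite -moduleM // (block_ortho ki) //.
exact: module0.
Qed.

End BlockTheory.

(** * Reading off an abelian ideal from a module *)

Section SeparatingModule.

Variables (F : fieldType) (p : nat) (hp : p \in [pchar F]).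
Variables (g : vectType F) (br : g -> g -> g) (brP : lie_axiom br).
Variables (pm : g -> g) (pmE : forall x y, br (pm x) y = iter p (br x) y).
Variables (S : {vspace g}) (idS : is_ideal br S) (abS : abelian_on br S).

Lemma abelian_ideal_ad2 s x : s \in S -> br s (br s x) = 0.
Proof. by move=> sS; apply: abS; rewrite // (br_anti brP) memvN idS. Qed.

(** Apply the Poincare-Birkhoff-Witt theorem to a basis X that begins with a
    basis of S and is completed by a basis of a complement.  The elements of S
    are assigned the p-th power 0, which is legitimate as ad(s)^2 = 0 for s in
    S; the other basis vectors keep their p-th power [pm]. *)
Lemma separating_module : exists X : seq g, <<X>>%VS = fullv /\
  exists (W : vectType F) (act : {linear g -> 'End(W)})
    (w1 : W) (aug : {linear W -> F^o}) (part1 : {linear W -> g}),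
  [/\ forall x y, act (br x y) = (act x \o act y)%VF - (act y \o act x)%VF,
      forall x, x \in X -> (x \in S /\ forall w, iter p (act x) w = 0) \/
        (forall w, iter p (act x) w = act (pm x) w),
      aug w1 = 1 /\ forall x w, aug (act x w) = 0,
      forall x, part1 (act x w1) = x
    & forall x w, x \in S -> aug w = 0 -> part1 (act x w) = 0].
Proof.
have p1 := prime_gt1 (pcharf_prime hp).
pose m := \dim S; pose n := (m + \dim (S^C))%N.
pose e : n.-tuple g := [tuple of vbasis S ++ vbasis (S^C)].
have e_basis : basis_of fullv e.
  rewrite -(addv_complf S); apply: cat_basis; try exact: vbasisP.
  by apply/directv_addP/capv_compl.
have eS (i : 'I_n) : (i < m)%N -> e`_i = (vbasis S)`_i.
  by move=> im; rewrite nth_cat size_tuple im.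
have eS_in (i : 'I_n) : (i < m)%N -> e`_i \in S.
  by move=> im; rewrite eS // vbasis_mem // memt_nth.
pose q (i : 'I_n) := if (i < m)%N then 0 else pm e`_i.
have q_ad (i : 'I_n) x : br (q i) x = iter p (br e`_i) x.
  rewrite /q; case: ifP => [im|_]; last exact: pmE.
  rewrite br0l // -(subnK p1) iterD /= abelian_ideal_ad2 ?eS_in //.
  by elim: (p - 2)%N => //= k <-; rewrite br0r.
exists e; split; first by case/andP: e_basis => /eqP.
have [W [act [w1 [aug [part1 [H1 H2 H3 H4 H5]]]]]] :=
  pbw_module hp brP e_basis q_ad.
exists W, act, w1, aug, part1; split=> // [x /tnthP[i ->]|x w xS w0].
  rewrite (tnth_nth 0); case: (ltnP i m) => im; [left | right] => [|w].
    by split=> [|w]; rewrite ?eS_in // H2 /q im linear0 zero_lfunE.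
  by rewrite H2 /q ltnNge im.
have abS_e (j k : 'I_n) : (j < m)%N -> (k < m)%N -> br e`_j e`_k = 0.
  by move=> jm km; apply: abS; apply: eS_in.
have qS (j : 'I_n) : (j < m)%N -> q j = 0 by rewrite /q => ->.
rewrite (coord_vbasis xS) linear_sum sum_lfunE linear_sum /=.
rewrite big1 // => i _; rewrite linearZ scale_lfunE linearZ /=.
have lti : (i < n)%N by rewrite (leq_trans (ltn_ord i)) ?leq_addr.
have im : (Ordinal lti < m)%N := ltn_ord i.
rewrite -(eS (Ordinal lti) im).
by rewrite (H5 m abS_e qS (Ordinal lti) w im w0) scaler0.
Qed.

End SeparatingModule.

Section Quotients.

Variables (F : fieldType) (V : vectType F) (br : V -> V -> V).
Hypothesis brP : lie_axiom br.
Variables (J : {vspace V}) (idJ : is_ideal br J).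

Lemma quo_proj_surj (a : quo J) : exists x, a = quo_proj J x.
Proof. by exists (quo_repr J a); rewrite quo_reprK. Qed.

Lemma quo_lie_axiom : lie_axiom (quo_bracket (J := J) br).
Proof.
have E x y : quo_bracket br (quo_proj J x) (quo_proj J y) = quo_proj J (br x y).
  exact: quo_bracketE.
split=> [b k a a'|a k b b'|a|a b c].
- have [x ->] := quo_proj_surj a; have [y ->] := quo_proj_surj a'.
  have [z ->] := quo_proj_surj b.
  by rewrite -linearP /= !E -linearP brDl // brZl.
- have [x ->] := quo_proj_surj a; have [y ->] := quo_proj_surj b.
  have [z ->] := quo_proj_surj b'.
  by rewrite -linearP /= !E -linearP brDr // brZr.
- by have [x ->] := quo_proj_surj a; rewrite E br_alt ?linear0.
have [x ->] := quo_proj_surj a; have [y ->] := quo_proj_surj b.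
have [z ->] := quo_proj_surj c.
by rewrite !E -!linearD /=; case: brP => _ _ _ ->; rewrite linear0.
Qed.

End Quotients.

Lemma iter_lfun0 (F : fieldType) (V : vectType F) m (v : V) :
  (0 < m)%N -> iter m (0 : 'End(V)) v = 0.
Proof. by case: m => //= m _; rewrite zero_lfunE. Qed.

Section PMapCheck.

Variables (F : fieldType) (p : nat) (hp : p \in [pchar F]).
Variables (L : restrictedLieAlgebra F p) (W : vectType F) (w0 : W).
Hypothesis w0_neq0 : w0 != 0.
Variables (f : {linear L -> 'End(W)}).
Hypothesis f_lie :
  forall x y, f (lie x y) = (f x \o f y)%VF - (f y \o f x)%VF.

Definition pmap_compatible (x : L) := forall w, f (Defs.pmap x) w = iter p (f x) w.

Lemma pmap_compatibleZ k x : pmap_compatible x -> pmap_compatible (k *: x).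
Proof.
have [_ pmZ _] := pmapP L.
have iterZ m w : iter m (f (k *: x)) w = k ^+ m *: iter m (f x) w.
  elim: m => [|m IH] /=; first by rewrite scale1r.
  by rewrite IH linearZ [f (k *: x)]linearZ /= scale_lfunE scalerA exprSr.
by move=> fx w; rewrite pmZ linearZ /= scale_lfunE fx iterZ.
Qed.

(** Both sides of the p-power relation obey the same additivity rule: the axiom
    for the p-map in L, Jacobson's formula in the endomorphism algebra. *)
Lemma pmap_compatibleD x y :
  pmap_compatible x -> pmap_compatible y -> pmap_compatible (x + y).
Proof.
have [_ _ pmD] := pmapP L.
move=> fx fy; have W_proper := dim_gt0 w0_neq0.
pose h : {linear L -> end_alg W_proper} := HB.pack (f : L -> end_alg W_proper)
  (GRing.isSemilinear.Build F L (end_alg W_proper) _ (f : L -> end_alg W_proper)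
    (GRing.semilinear_linear (linearP f))).
have h_p z : pmap_compatible z -> h (Defs.pmap z) = h z ^+ p.
  by move=> fz; apply/lfunP => w; rewrite end_alg_exp; apply: fz.
have h_lie a b : h (lie a b) = h a * h b - h b * h a by exact: f_lie.
have := jacobson_formula hp h_lie x y.
rewrite -!h_p // -linear_sum -linearD -linearD -linearD -pmD => J w.
by rewrite -[RHS](end_alg_exp (h (x + y))) J.
Qed.

Lemma pmap_compatible_lin k x y :
  pmap_compatible x -> pmap_compatible y -> pmap_compatible (k *: x + y).
Proof. by move=> fx fy; apply/pmap_compatibleD/fy/pmap_compatibleZ. Qed.

End PMapCheck.

Section ChiefFactor.

Variables (F : fieldType) (p : nat) (hp : p \in [pchar F]).
Variables (L : restrictedLieAlgebra F p) (J I : {vspace L}).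
Hypotheses (idJ : lie_ideal J) (idI : lie_ideal I) (JI : (J <= I)%VS).
Hypothesis abIJ : abelian_factor J I.

Let lieL : lie_axiom (@lie F p L) := lieP L.

Lemma abelian_factor_lie x y : x \in I -> y \in I -> lie x y \in J.
Proof.
move=> xI yI; rewrite -quo_proj_eq0 -quo_bracketE //.
by apply/eqP/abIJ; apply: memv_img.
Qed.

(** The elements x with [L, x] contained in J: the preimage of the centre of L/J. *)
Definition factor_annihilator : {vspace L} :=
  (\bigcap_(i < \dim {:L}) (linfun (lie ((vbasis {:L})`_i)) @^-1: J))%VS.

Lemma factor_annihilatorP x :
  reflect (forall y, lie y x \in J) (x \in factor_annihilator).
Proof.
rewrite memvE; apply: (iffP subv_bigcapP) => [H y|H i _]; last first.
  by rewrite -memvE -memv_preim lfunE H.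
rewrite (coord_vbasis (memvf y)) br_suml //; apply: rpred_sum => i _.
rewrite brZl // rpredZ //.
by have := H i isT; rewrite -memvE -memv_preim lfunE.
Qed.

Let Z := factor_annihilator.

Lemma sub_factor_annihilator x : x \in J -> x \in Z.
Proof. by move=> xJ; apply/factor_annihilatorP => y; apply: idJ. Qed.

Lemma factor_annihilator_ideal : lie_ideal Z.
Proof.
move=> x y yZ; apply/factor_annihilatorP => z.
by apply: idJ; move/factor_annihilatorP: yZ; apply.
Qed.

Lemma lie_annihilator x y : x \in Z -> lie x y \in J.
Proof.
by move=> xZ; rewrite br_anti // memvN; move/factor_annihilatorP: xZ; apply.
Qed.

Lemma iter_lieJ k m x y : (k <= m)%N ->
  iter k (lie x) y \in J -> iter m (lie x) y \in J.
Proof.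
by move=> /subnK <- yJ; rewrite iterD; elim: (m - k)%N => //= d; apply: idJ.
Qed.

Lemma pmap_annihilator x : x \in Z -> Defs.pmap x \in Z.
Proof.
have [pm_ad _ _] := pmapP L; have p1 := prime_gt1 (pcharf_prime hp).
move=> xZ; apply/factor_annihilatorP => y.
rewrite br_anti // memvN pm_ad; apply: iter_lieJ (ltnW p1) _.
exact: lie_annihilator.
Qed.

(** For x in I + Z, ad(x) maps L into I and I into J. *)
Lemma pmap_abelian_annihilator x :
  quo_proj Z x \in (quo_proj Z @: I)%VS -> Defs.pmap x \in Z.
Proof.
have [pm_ad _ _] := pmapP L; have p1 := prime_gt1 (pcharf_prime hp).
case/memv_imgP => i iI /eqP; rewrite -subr_eq0 -linearB quo_proj_eq0 => xiZ.
apply/factor_annihilatorP => y.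
rewrite br_anti // memvN pm_ad; apply: iter_lieJ p1 _.
have split z : lie x z = lie (x - i) z + lie i z by rewrite -brDl // subrK.
have lieI z : lie x z \in I.
  rewrite split memvD ?(subvP JI _ (lie_annihilator _ xiZ)) //.
  by rewrite br_anti // memvN idI.
rewrite /= (split (lie x y)); apply: memvD; first exact: lie_annihilator.
exact: abelian_factor_lie iI (lieI y).
Qed.

Lemma quotient_pmap_ad (a b : quo Z) :
  quo_bracket (@lie F p L) (quo_proj Z (Defs.pmap (quo_repr Z a))) b =
  iter p (quo_bracket (@lie F p L) a) b.
Proof.
have [pm_ad _ _] := pmapP L.
have [y ->] := quo_proj_surj b.
rewrite quo_bracketE //; last exact: factor_annihilator_ideal.
rewrite pm_ad -{2}[a]quo_reprK; move: (quo_repr Z a) => x.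
have E m : iter m (quo_bracket (@lie F p L) (quo_proj Z x)) (quo_proj Z y) =
    quo_proj Z (iter m (lie x) y).
  by elim: m => //= m ->; apply: quo_bracketE => //; apply: factor_annihilator_ideal.
by rewrite E.
Qed.

(** The module of [separating_module] for L/Z and the image of I is a restricted
    L-module: the p-power relation holds on Z, where both sides vanish, and on
    representatives of a basis of L/Z.  For those in I + Z it reads 0 = 0, by
    [pmap_abelian_annihilator]. *)
Lemma annihilator_module : exists (W : vectType F) (f : {linear L -> 'End(W)})
    (w1 : W) (aug : {linear W -> F^o}) (part1 : {linear W -> quo Z}),
  [/\ (forall x y, f (lie x y) = (f x \o f y)%VF - (f y \o f x)%VF) /\
        (forall x w, f (Defs.pmap x) w = iter p (f x) w),
      forall x, x \in Z -> f x = 0,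
      aug w1 = 1 /\ forall x w, aug (f x w) = 0,
      forall x, part1 (f x w1) = quo_proj Z x
    & forall x w, x \in I -> aug w = 0 -> part1 (f x w) = 0].
Proof.
pose br := quo_bracket (J := Z) (@lie F p L).
have brE x y : br (quo_proj Z x) (quo_proj Z y) = quo_proj Z (lie x y).
  by apply: quo_bracketE => //; apply: factor_annihilator_ideal.
have brP : lie_axiom br by apply: quo_lie_axiom => //; apply: factor_annihilator_ideal.
pose S := (quo_proj Z @: I)%VS.
have idS : is_ideal br S.
  move=> a _ /memv_imgP[y yI ->]; have [x ->] := quo_proj_surj a.
  by rewrite brE memv_img // idI.
have abS : abelian_on br S.
  move=> _ _ /memv_imgP[x xI ->] /memv_imgP[y yI ->]; rewrite brE.
  apply/eqP; rewrite quo_proj_eq0; apply: sub_factor_annihilator.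
  exact: abelian_factor_lie.
have [X [spanX [W [act [w1 [aug [part1 [H1 H2 H3 H4 H5]]]]]]]] :=
  separating_module hp brP quotient_pmap_ad idS abS.
pose f0 x := act (quo_proj Z x).
have f0_lin : linear f0 by move=> k x y; rewrite /f0 !linearP.
pose f : {linear L -> 'End(W)} := HB.pack f0
  (GRing.isSemilinear.Build F L 'End(W) _ f0 (GRing.semilinear_linear f0_lin)).
have fE x : f x = act (quo_proj Z x) by [].
have f_lie x y : f (lie x y) = (f x \o f y)%VF - (f y \o f x)%VF.
  by rewrite !fE -H1 brE.
have f0Z x : x \in Z -> f x = 0.
  by rewrite -quo_proj_eq0 fE => /eqP ->; rewrite linear0.
have w10 : w1 != 0.
  by case: H3 => w1a _; apply: contra_eq_neq w1a => ->; rewrite linear0 eq_sym oner_eq0.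
have compat_lin := pmap_compatible_lin hp w10 f_lie.
have compatZ x : x \in Z -> pmap_compatible f x.
  move=> xZ w; rewrite !f0Z ?pmap_annihilator // zero_lfunE.
  by rewrite iter_lfun0 // prime_gt0 // (pcharf_prime hp).
have compatX a : a \in X -> pmap_compatible f (quo_repr Z a).
  move=> aX w; rewrite !fE quo_reprK; case: (H2 a aX) => [[aS ->]|->] //.
  suff /eqP-> : quo_proj Z (Defs.pmap (quo_repr Z a)) == 0.
    by rewrite linear0 zero_lfunE.
  by rewrite quo_proj_eq0 pmap_abelian_annihilator // quo_reprK.
have compat x : pmap_compatible f x.
  rewrite -[x](subrK (quo_repr Z (quo_proj Z x))) -[x - _]scale1r.
  apply: (compat_lin); first by apply: compatZ; rewrite -memvN opprB quo_projK.
  have : quo_proj Z x \in <<X>>%VS by rewrite spanX memvf.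
  move/(@coord_span _ _ _ (in_tuple X)) => ->; rewrite linear_sum.
  elim/big_rec: _ => [|i y _ yc]; first by apply: compatZ; rewrite mem0v.
  by rewrite linearZ; apply: compat_lin => //; apply: compatX; apply: mem_nth.
exists W, f, w1, aug, part1; split=> [//|//||x|x w xI w0].
- by case: H3 => -> aug0; split=> // x w; rewrite fE.
- by rewrite fE H4.
by rewrite fE H5 // memv_img.
Qed.

End ChiefFactor.

(** * The factor I / J as a module *)

Section FactorModule.

Variables (F : fieldType) (p : nat) (hp : p \in [pchar F]).
Variables (L : restrictedLieAlgebra F p) (J I : {vspace L}).
Hypotheses (idJ : lie_ideal J) (idI : lie_ideal I).

Let lieL : lie_axiom (@lie F p L) := lieP L.

Notation S := (subvs_of (factor J I)).
Notation rho := (factor_action J I).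

Definition factor_class (y : L) : S := vsproj (factor J I) (quo_proj J y).

Lemma factor_class_linear : linear factor_class.
Proof. by move=> k x y; rewrite /factor_class !linearP. Qed.

HB.instance Definition _ := GRing.isSemilinear.Build F L S _ factor_class
  (GRing.semilinear_linear factor_class_linear).

Lemma factor_classK y : y \in I -> vsval (factor_class y) = quo_proj J y.
Proof. by move=> yI; rewrite vsprojK ?memv_img. Qed.

Lemma factor_class_surj (s : S) : exists2 y, y \in I & s = factor_class y.
Proof.
have /memv_imgP[y yI sy] := subvsP s; exists y => //.
by apply: val_inj; rewrite [RHS]factor_classK.
Qed.

Lemma factor_class_eq0 y : y \in I -> (factor_class y == 0) = (y \in J).
Proof.
by move=> yI; rewrite -quo_proj_eq0 -factor_classK.
Qed.

Lemma factor_action_class x y : y \in I ->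
  rho x (factor_class y) = factor_class (lie x y).
Proof.
move=> yI; apply: val_inj; rewrite [LHS]factor_actionE //; symmetry; apply: factor_classK.
exact: idI.
Qed.

Lemma factor_action_linear : linear rho.
Proof.
move=> k x y; apply/lfunP => s; have [z zI ->] := factor_class_surj s.
rewrite add_lfunE scale_lfunE !factor_action_class // -linearP.
by rewrite brDl // brZl.
Qed.

HB.instance Definition _ := GRing.isSemilinear.Build F L 'End(S) _ rho
  (GRing.semilinear_linear factor_action_linear).

Lemma factor_action_lie x y : rho (lie x y) = (rho x \o rho y)%VF - (rho y \o rho x)%VF.
Proof.
apply/lfunP => s; have [z zI ->] := factor_class_surj s.
rewrite add_lfunE opp_lfunE (comp_lfunE (rho x)) (comp_lfunE (rho y)).
rewrite !factor_action_class ?idI // -linearB.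
congr factor_class.
by rewrite br_leibniz.
Qed.

Lemma factor_action_pmap x s : rho (Defs.pmap x) s = iter p (rho x) s.
Proof.
have [z zI ->] := factor_class_surj s; have [pm_ad _ _] := pmapP L.
rewrite factor_action_class // pm_ad.
suff E m : iter m (lie x) z \in I /\
    factor_class (iter m (lie x) z) = iter m (rho x) (factor_class z).
  by case: (E p).
elim: m => //= m [mI E]; split; first exact: idI.
by rewrite -E factor_action_class.
Qed.

(** Submodules of I/J are the ideals of L/J contained in it. *)
Lemma factor_irreducible (W : {vspace S}) :
    minimal_ideal (quo_bracket (@lie F p L)) (factor J I) ->
    (forall x, rho x @: W <= W)%VS -> W <> 0%VS -> W = fullv.
Proof.
case=> _ _ minI stab W0.
pose K := (linfun (@vsval F _ (factor J I)) @: W)%VS.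
have valK (s : S) : (vsval s \in K) = (s \in W).
  apply/idP/idP => [/memv_imgP[t tW]|sW].
    by rewrite lfunE => /val_inj ->.
  by apply/memv_imgP; exists s; rewrite // lfunE.
have eK : K = factor J I.
  apply: minI.
  - move=> a _ /memv_imgP[s sW ->]; rewrite lfunE /=.
    have [y yI sE] := factor_class_surj s; rewrite {1}sE factor_classK //.
    have [x ->] := quo_proj_surj a; rewrite quo_bracketE //.
    rewrite -(factor_actionE (I := I)) // -/(factor_class y) -sE valK.
    by apply: (subvP (stab x)); apply: memv_img.
  - by apply/subvP => _ /memv_imgP[s _ ->]; rewrite lfunE subvsP.
  move=> K0; apply: W0; apply/eqP; rewrite -subv0; apply/subvP => s.
  by rewrite -valK K0 !memv0.
by apply/vspaceP => s; rewrite memvf -valK eK subvsP.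
Qed.

End FactorModule.

(** * The principal block *)

Section PrincipalBlockCriterion.

Variables (F : fieldType) (p : nat) (hp : p \in [pchar F]).
Variables (L : restrictedLieAlgebra F p) (J I : {vspace L}).
Hypotheses (idJ : lie_ideal J) (idI : lie_ideal I) (JI : (J <= I)%VS).
Hypothesis abIJ : abelian_factor J I.
Variables (U : falgType F) (iota : {linear L -> U}).
Hypothesis hU : restricted_enveloping iota.

Notation S := (subvs_of (factor J I)).
Notation rho := (factor_action J I).

Variables (act0 : U -> 'End(F^o)) (actS : U -> 'End(S)).
Hypothesis act0P : extends_action iota (@trivial_action F p L) act0.
Hypothesis actSP : extends_action iota rho actS.

Lemma trivial_factor_eps : (forall x y, y \in I -> lie x y \in J) ->
  forall u s, actS u s = (act0 u 1 : F) *: s.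
Proof.
move=> triv u s; have [m0 e0] := act0P; have [mS eS] := actSP.
elim/(enveloping_ind hU): u => [|k a b IHa IHb|x a IH].
- by rewrite !module1 // scale1r.
- by rewrite !module_lin // IHa IHb scalerDl scalerA.
rewrite !moduleM // eS e0 zero_lfunE scale0r.
have [y yI ->] := factor_class_surj (actS a s).
rewrite factor_action_class //; apply/eqP.
by rewrite factor_class_eq0 ?idI // triv.
Qed.

(** In the module W of [annihilator_module], let K be the submodule I W+, with W+
    the kernel of the augmentation.  The map s |-> theta s = x w1, for s the
    class of x, is equivariant modulo K, so that f acts on theta s as the
    identity modulo K; by centrality f x w1 = x f w1, and f w1 lies in W+ since
    f kills the trivial module.  Thus theta s lies in K, on which the degree-one
    part vanishes, and x lies in Z. *)
Lemma central_acting_as_id (f : U) : (forall u, f * u = u * f) ->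
  act0 f = 0 -> actS f = \1%VF -> factor J I = 0%VS.
Proof.
move=> f_central f0 f1; have [m0 e0] := act0P; have [mS eS] := actSP.
have [W [psi0 [w1 [aug [part1 [[psi_lie psi_p] psiZ [aug1 aug0] part1_w1 part1_0]]]]]] :=
  annihilator_module hp idJ idI JI abIJ.
have w1n : w1 != 0.
  by apply: contra_eq_neq aug1 => ->; rewrite linear0 eq_sym oner_eq0.
have [psi [mW eW]] := extend_rep hU w1n psi_lie psi_p.
have aug_psi u w : aug (psi u w) = (act0 u 1 : F) * aug w.
  elim/(enveloping_ind hU): u => [|k a b IHa IHb|x a IH].
  - by rewrite !module1 // mul1r.
  - by rewrite !module_lin // linearP IHa IHb mulrDl scalerAl.
  by rewrite !moduleM // eW e0 zero_lfunE mul0r aug0.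
pose K := (\sum_(i < \dim I) (psi0 (vbasis I)`_i @: lker (linfun aug)))%VS.
have K_in x w : x \in I -> aug w = 0 -> psi0 x w \in K.
  move=> xI w0; rewrite (coord_vbasis xI) linear_sum sum_lfunE.
  apply: rpred_sum => i _; rewrite linearZ scale_lfunE rpredZ //.
  apply: (subvP (sumv_sup i isT (subvv _))); apply: memv_img.
  by rewrite memv_ker lfunE /= w0.
have K_ind (D : {vspace W}) :
    (forall x w, x \in I -> aug w = 0 -> psi0 x w \in D) -> (K <= D)%VS.
  move=> HD; apply/subv_sumP => i _; apply/subvP => _ /memv_imgP[w wK ->].
  apply: HD; last by move: wK; rewrite memv_ker lfunE => /eqP.
  by rewrite vbasis_mem // memt_nth.
have part1_K w : w \in K -> part1 w = 0.
  suff KD : (K <= lker (linfun part1))%VS.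
    by move/(subvP KD); rewrite memv_ker lfunE => /eqP.
  by apply: K_ind => x v xI v0; rewrite memv_ker lfunE /= part1_0.
have psi_comm y x w : psi0 y (psi0 x w) = psi0 x (psi0 y w) + psi0 (lie y x) w.
  by rewrite psi_lie add_lfunE opp_lfunE !comp_lfunE addrC subrK.
have K_psi0 y w : w \in K -> psi0 y w \in K.
  suff KD : (K <= psi0 y @^-1: K)%VS by move/(subvP KD); rewrite memv_preim.
  apply: K_ind => x v xI v0; rewrite -memv_preim psi_comm.
  by apply: memvD; apply: K_in; rewrite ?idI ?aug0.
pose theta (s : S) := psi0 (quo_repr J (vsval s)) w1.
have thetaE x : x \in I -> theta (factor_class J I x) = psi0 x w1.
  move=> xI; rewrite /theta factor_classK //.
  apply/eqP; rewrite -subr_eq0 -opp_lfunE -add_lfunE -linearB.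
  by rewrite psiZ ?zero_lfunE // sub_factor_annihilator ?quo_projK.
have theta_lin k s t : theta (k *: s + t) = k *: theta s + theta t.
  by rewrite /theta !linearP add_lfunE scale_lfunE.
have psi_theta u s : psi u (theta s) - theta (actS u s) \in K.
  elim/(enveloping_ind hU): u => [|k a b IHa IHb|y a IH].
  - by rewrite !module1 // subrr mem0v.
  - rewrite !module_lin // theta_lin opprD addrACA -scalerN -scalerDr.
    by rewrite memvD ?memvZ.
  rewrite !moduleM // eW eS; have [x xI E] := factor_class_surj (actS a s).
  rewrite E factor_action_class // thetaE ?idI //.
  rewrite E thetaE // in IH.
  rewrite -[psi a _](subrK (psi0 x w1)) linearD /= -addrA memvD ?K_psi0 //.
  by rewrite psi_comm addrK K_in.
have I_Z x : x \in I -> x \in factor_annihilator J.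
  move=> xI; rewrite -quo_proj_eq0 -part1_w1 part1_K //.
  have := psi_theta f (factor_class J I x).
  rewrite f1 id_lfunE thetaE // -eW -moduleM // f_central moduleM // eW => H.
  have fK : psi0 x (psi f w1) \in K.
    by apply: K_in; rewrite // aug_psi f0 zero_lfunE mul0r.
  by rewrite -[psi0 x w1](subKr (psi0 x (psi f w1))) memvB.
have triv x y : y \in I -> lie x y \in J.
  by move/I_Z/factor_annihilatorP.
apply/eqP; rewrite -subv0; apply/subvP => a aS; rewrite memv0.
have := trivial_factor_eps triv f (Subvs aS).
by rewrite f1 id_lfunE f0 zero_lfunE scale0r => /(congr1 vsval) /= ->.
Qed.

End PrincipalBlockCriterion.

Lemma line_irreducible (F : fieldType) (W : {vspace F^o}) : W <> 0%VS -> W = fullv.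
Proof.
move=> /eqP W0; apply/eqP; rewrite -dimv_leqif_eq ?subvf // dimvf.
by rewrite eqn_leq -{1}(dimvf F^o) dimvS ?subvf //= lt0n dimv_eq0.
Qed.

Theorem proposition5p4 (F : fieldType) (p : nat) (hp : p \in [pchar F])
  (L : restrictedLieAlgebra F p)
  (U : falgType F) (iota : {linear L -> U})
  (hU : restricted_enveloping iota)
  (n : nat) (Ls : nat -> {vspace L}) (hLs : chief_series n Ls)
  (j : nat) (hj : (j < n)%N) (hab : abelian_factor (Ls j) (Ls j.+1)) :
  in_principal_block iota (factor_action (Ls j) (Ls j.+1)).
Proof.
case: hLs => _ _ idLs /(_ j hj)[JI _] /(_ j hj) minI.
have idJ := idLs j (ltnW hj); have idI := idLs j.+1 hj.
have [_ /eqP nz _] := minI.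
have [s s0] : exists s : subvs_of (factor (Ls j) (Ls j.+1)), s != 0.
  exists (Subvs (memv_pick (factor (Ls j) (Ls j.+1)))).
  by rewrite -(inj_eq val_inj) /= vpick0.
have [actS actSP] := extend_rep hU s0 (factor_action_lie idJ idI)
  (factor_action_pmap idJ idI).
have triv_lin : linear (@trivial_action F p L).
  by move=> k x y; rewrite scaler0 addr0.
pose triv : {linear L -> 'End(F^o)} := HB.pack (@trivial_action F p L)
  (GRing.isSemilinear.Build F L 'End(F^o) _ (@trivial_action F p L)
    (GRing.semilinear_linear triv_lin)).
have [|x w|act0 act0P] := @extend_rep _ _ _ _ _ hU F^o 1 triv (oner_neq0 _).
- by move=> x y; rewrite comp_lfun0l subrr.
- by rewrite iter_lfun0 ?zero_lfunE // prime_gt0 // (pcharf_prime hp).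
have [r [Bs hB]] := block_decomposition_exists U.
have [i0 block0] : exists i, in_block Bs i act0.
  apply: (irreducible_in_block hB (proj1 act0P) (oner_neq0 F)) => W _.
  exact: line_irreducible.
have [i blockS] : exists i, in_block Bs i actS.
  apply: (irreducible_in_block hB (proj1 actSP) s0) => W stab.
  apply: (factor_irreducible idJ idI minI) => x.
  by case: actSP => _ <-; apply: stab.
exists r, Bs, i0; split=> //; first by exists act0.
have [<-|ii0] := eqVneq i i0; first by exists actS.
have [e [e_in sum_e e_central]] := block_idempotents hB.
case/eqP: nz.
apply: (central_acting_as_id hp idJ idI JI hab hU act0P actSP (e_central i)).
  by case: block0 => _ /(_ i ii0 _ (e_in i)).
(* The other idempotents kill the factor, so e i acts as their sum with e i,
   which is 1. *)
apply/lfunP => t; rewrite id_lfunE -[RHS](module1 (proj1 actSP)) -sum_e.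
rewrite (module_sum (proj1 actSP)) (bigD1 i) //= big1 ?addr0 // => k ki.
by case: blockS => _ /(_ k ki _ (e_in k)) ->; rewrite zero_lfunE.
Qed.
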